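(* Let $f(\xi)\in\mathbb{Z}_p[\xi_1,\ldots,\xi_n]$ be a quasielliptic polynomial of degree $d$ with respect to $\boldsymbol{w}$, and let $\alpha>0$. For $r\in\mathbb{N}\setminus\{0\}$ and $t>0$ set $$\varphi_{r,t}(x)=\mathcal{F}^{-1}\left((1-\Omega_{-r}(\xi))\,e^{-t|f(\xi)|_p^\alpha}\right),\qquad Z(x,t)=\int_{\mathbb{Q}_p^n}\Psi(x\cdot\xi)\,e^{-t|f(\xi)|_p^\alpha}\,d^n\xi .$$ Then: (1) $\varphi_{r,t}(x)\in\widetilde{H}_\infty$ for any $r\in\mathbb{N}\setminus\{0\}$ and $t>0$. (2) $Z(x,t)\in\widetilde{H}_\infty$ for any $t>0$.
   Context: $p$ is a prime, $|\cdot|_p$ the $p$-adic absolute value on $\mathbb{Q}_p$, $\|x\|_p=\max_i|x_i|_p$ on $\mathbb{Q}_p^n$, and $0\in\mathbb{N}$. A non-constant polynomial $f(\xi)\in\mathbb{Q}_p[\xi_1,\ldots,\xi_n]$ is called quasielliptic of degree $d$ with respect to $\boldsymbol{w}=(w_1,\ldots,w_n)\in(\mathbb{N}\setminus\{0\})^n$ if: (Q1) $f(\lambda^{w_1}\xi_1,\ldots,\lambda^{w_n}\xi_n)=\lambda^d f(\xi)$ for all $\lambda\in\mathbb{Q}_p^\times$; and (Q2) $f(\xi)=0\Leftrightarrow \xi=0$. By convention all quasielliptic polynomials are assumed to have coefficients in $\mathbb{Z}_p$. Set $\Xi(\xi)=\sum_{i=1}^n|\xi_i|_p^{d/w_i}$.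 For $l\in\mathbb{Z}$, $\Omega_l(x)=1$ if $\|x\|_p\leq p^l$ and $\Omega_l(x)=0$ if $\|x\|_p>p^l$. $S=S(\mathbb{Q}_p^n)$ is the space of Schwartz--Bruhat functions. $\Psi:\mathbb{Q}_p\to\mathbb{C}^\times$ is the standard additive character, $(\mathcal{F}\phi)(\xi)=\int_{\mathbb{Q}_p^n}\Psi(-x\cdot\xi)\phi(x)\,d^nx$, with $d^nx$ the Haar measure normalized by $\mathrm{vol}(\mathbb{Z}_p^n)=1$. For $\beta\geq0$ put $\|\phi\|_\beta^2=\int_{\mathbb{Q}_p^n}\Xi^{2\beta}(\xi)|\mathcal{F}(\phi)(\xi)|^2d^n\xi$. Let $\Phi=\{\phi\in S:\mathcal{F}(\phi)(0)=0\}$, and let $\widetilde{H}_\beta$ be the completion of $(\Phi,\|\cdot\|_\beta)$, identified via $\mathcal{F}$ with $L^2(\mathbb{Q}_p^n,\Xi^{2\beta}(\xi)d^n\xi)$; in particular $\widetilde{H}_0=L^2(\mathbb{Q}_p^n)$. $\widetilde{H}_\infty$ is the completion of $\bigcap_{\beta\in\mathbb{N}}\widetilde{H}_\beta$ for the metric $\rho(x,y)=\max_{\beta\in\mathbb{N}}\left\{c_\beta\frac{\|x-y\|_\beta}{1+\|x-y\|_\beta}\right\}$, with $\{c_\beta\}$ a fixed null-sequence of positive numbers; it equals $(\bigcap_{\beta\in\mathbb{N}}\widetilde{H}_\beta,\rho)$. Functions are identified when equal almost everywhere. *)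

(* Defs.v *)
From HB Require Import structures.
From mathcomp Require Import all_boot all_order all_algebra.
From mathcomp Require Import fraction generic_quotient complex.
From mathcomp Require mpoly.
From mathcomp Require Import all_classical all_reals all_analysis.

Set Implicit Arguments.
Unset Strict Implicit.
Unset Printing Implicit Defensive.

Import Order.TTheory GRing.Theory Num.Theory.

(* Z_p is the inverse limit of the rings Z / p ^ k Z: the k-th component is
   the representative of the class modulo p ^ k that lies in [0, p ^ k). *)
Record padic_int (p : nat) (p_pr : prime p) := PadicInt {
  residue :> nat -> nat;
  residueP : forall k, residue k.+1 %% p ^ k = residue k }.

Section PadicIntRing.
Variables (p : nat) (p_pr : prime p).
Notation Zp := (padic_int p_pr).
Implicit Types x y z : Zp.

HB.instance Definition _ := gen_eqMixin Zp.
HB.instance Definition _ := gen_choiceMixin Zp.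

Lemma expp_gt0 k : 0 < p ^ k.
Proof. by rewrite expn_gt0 prime_gt0. Qed.

Lemma padic_int_eq x y : residue x =1 residue y -> x = y.
Proof.
case: x y => [x xP] [y yP] /= /funext exy.
by rewrite exy in xP *; congr PadicInt; apply: Prop_irrelevance.
Qed.

Lemma residue_lt x k : x k < p ^ k.
Proof. by rewrite -residueP ltn_mod expp_gt0. Qed.

Lemma residue_mod x k : x k %% p ^ k = x k.
Proof. by rewrite modn_small ?residue_lt. Qed.

Lemma residue_le x k l : k <= l -> x l %% p ^ k = x k.
Proof.
elim: l => [|l IH]; first by rewrite leqn0 => /eqP->; exact: residue_mod.
rewrite leq_eqVlt => /predU1P[->|]; first exact: residue_mod.
rewrite ltnS => kl; rewrite -(IH kl) -(residueP x l) modn_dvdm //.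
exact: dvdn_exp2l.
Qed.

Lemma mk_residueP (f : nat -> nat) :
  (forall k, f k.+1 = f k %[mod p ^ k]) ->
  forall k, (f k.+1 %% p ^ k.+1) %% p ^ k = f k %% p ^ k.
Proof. by move=> fP k; rewrite modn_dvdm ?fP // dvdn_exp2l. Qed.

Definition mk_padic_int f (fP : forall k, f k.+1 = f k %[mod p ^ k]) : Zp :=
  PadicInt p_pr (mk_residueP fP).

Fact zp_const_subproof (a k : nat) : a = a %[mod p ^ k]. Proof. by []. Qed.
Definition zp_const a : Zp := mk_padic_int (zp_const_subproof a).

Fact zp_add_subproof x y k :
  x k.+1 + y k.+1 = x k + y k %[mod p ^ k].
Proof. by rewrite -modnDm !residueP. Qed.
Definition zp_add x y : Zp := mk_padic_int (zp_add_subproof x y).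

Fact zp_mul_subproof x y k :
  x k.+1 * y k.+1 = x k * y k %[mod p ^ k].
Proof. by rewrite -modnMm !residueP. Qed.
Definition zp_mul x y : Zp := mk_padic_int (zp_mul_subproof x y).

Fact zp_opp_subproof x k :
  p ^ k.+1 - x k.+1 = p ^ k - x k %[mod p ^ k].
Proof.
apply/eqP; rewrite -(eqn_modDr (x k.+1)) subnK; last exact/ltnW/residue_lt.
rewrite -modnDmr residueP subnK; last exact/ltnW/residue_lt.
by rewrite expnS modnMl modnn.
Qed.
Definition zp_opp x : Zp := mk_padic_int (zp_opp_subproof x).

Fact zp_addA : associative zp_add.
Proof.
by move=> x y z; apply: padic_int_eq => k /=; rewrite modnDml modnDmr addnA.
Qed.
Fact zp_addC : commutative zp_add.
Proof. by move=> x y; apply: padic_int_eq => k /=; rewrite addnC. Qed.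
Fact zp_add0 : left_id (zp_const 0) zp_add.
Proof.
by move=> x; apply: padic_int_eq => k /=; rewrite mod0n add0n residue_mod.
Qed.
Fact zp_addN : left_inverse (zp_const 0) zp_opp zp_add.
Proof.
move=> x; apply: padic_int_eq => k /=.
by rewrite modnDml subnK ?modnn ?mod0n // ltnW ?residue_lt.
Qed.
HB.instance Definition _ :=
  GRing.isZmodule.Build Zp zp_addA zp_addC zp_add0 zp_addN.

Fact zp_mulA : associative zp_mul.
Proof.
by move=> x y z; apply: padic_int_eq => k /=; rewrite modnMml modnMmr mulnA.
Qed.
Fact zp_mulC : commutative zp_mul.
Proof. by move=> x y; apply: padic_int_eq => k /=; rewrite mulnC. Qed.
Fact zp_mul1 : left_id (zp_const 1) zp_mul.
Proof.
by move=> x; apply: padic_int_eq => k /=; rewrite modnMml mul1n residue_mod.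
Qed.
Fact zp_mulDl : left_distributive zp_mul zp_add.
Proof.
by move=> x y z; apply: padic_int_eq => k /=; rewrite modnMml modnDm mulnDl.
Qed.
Fact zp_1neq0 : zp_const 1 != zp_const 0.
Proof.
apply/eqP => /(congr1 (fun x => residue x 1)) /=.
by rewrite expn1 mod0n modn_small ?prime_gt1.
Qed.
HB.instance Definition _ :=
  GRing.Zmodule_isComNzRing.Build Zp zp_mulA zp_mulC zp_mul1 zp_mulDl zp_1neq0.

Local Open Scope ring_scope.

Definition zp_unit : {pred Zp} := fun x => `[< exists y, y * x = 1 >].
Definition zp_inv x : Zp := xget x [set y | y * x = 1]%classic.

Fact zp_mulVx : {in zp_unit, left_inverse 1 zp_inv *%R}.
Proof. by move=> x /asboolP /xgetPex; apply. Qed.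
Fact zp_unitPl x y : y * x = 1 -> zp_unit x.
Proof. by move=> xy; apply/asboolP; exists y. Qed.
Fact zp_inv_out : {in [predC zp_unit], zp_inv =1 id}.
Proof.
by move=> x /asboolPn xV; apply: xgetPN => y yx; apply: xV; exists y.
Qed.
HB.instance Definition _ :=
  GRing.ComNzRing_hasMulInverse.Build Zp zp_mulVx zp_unitPl zp_inv_out.

(* The largest k such that p ^ k divides x; the value at 0 is irrelevant. *)
Definition zp_val x : nat := xget 0%N [set k | x k = 0%N /\ x k.+1 <> 0%N]%classic.

Lemma zp_valP x : x != 0 -> x (zp_val x) = 0%N /\ x (zp_val x).+1 <> 0%N.
Proof.
move=> x0; suff /xgetPex: exists k, x k = 0%N /\ x k.+1 <> 0%N by apply.
have /existsNP[k xk] : ~ forall k, x k = 0%N.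
  move=> xE; case/eqP: x0; apply: padic_int_eq => k.
  by rewrite xE /= mod0n.
elim: k xk => [|k IH] xk.
  by have := residue_lt x 0; rewrite expn0 ltnS leqn0 => /eqP.
by have [xk0|/IH] := pselect (x k = 0%N); [exists k|].
Qed.

Lemma zp_valE x k : x k = 0%N -> x k.+1 <> 0%N -> zp_val x = k.
Proof.
move=> xk xSk; have x0 : x != 0.
  by apply/eqP => x0; rewrite x0 /= mod0n in xSk.
have [xv xSv] := zp_valP x0.
have H a b : x a = 0%N -> (b <= a)%N -> x b = 0%N.
  by move=> xa ba; rewrite -(residue_le x ba) xa mod0n.
by apply/eqP; rewrite eqn_leq; apply/andP; split; rewrite leqNgt;
  apply/negP => lt; [apply: xSk|apply: xSv]; apply: H lt.
Qed.

Lemma zp_val_le x k : x != 0 -> (k <= zp_val x)%N = (x k == 0%N).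
Proof.
move=> x0; have [xv xSv] := zp_valP x0; apply/idP/eqP => [kv|xk].
  by rewrite -(residue_le x kv) xv mod0n.
rewrite leqNgt; apply/negP => vk; apply: xSv.
by rewrite -(residue_le x vk) xk mod0n.
Qed.

Lemma zp_logn x k : x != 0 -> (zp_val x < k)%N ->
  (0 < x k)%N /\ logn p (x k) = zp_val x.
Proof.
move=> x0 vk; have [xv xSv] := zp_valP x0.
have xk0 : (0 < x k)%N.
  rewrite lt0n; apply/eqP => xk; apply: xSv.
  by rewrite -(residue_le x vk) xk mod0n.
split=> //; apply/eqP; rewrite eqn_leq; apply/andP; split.
  rewrite leqNgt; apply/negP; rewrite -pfactor_dvdn //.
  by move=> /eqP xk; apply: xSv; rewrite -(residue_le x vk).
by rewrite -pfactor_dvdn // /dvdn residue_le ?xv // ltnW.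
Qed.

Lemma zp_valM_aux x y : x != 0 -> y != 0 ->
  (x * y) (zp_val x + zp_val y)%N = 0%N /\
  (x * y) (zp_val x + zp_val y).+1 <> 0%N.
Proof.
move=> x0 y0; set a := zp_val x; set b := zp_val y.
set N := (a + b).+1.
have [xN vx] : (0 < x N)%N /\ logn p (x N) = a.
  by apply: zp_logn; rewrite // ltnS leq_addr.
have [yN vy] : (0 < y N)%N /\ logn p (y N) = b.
  by apply: zp_logn; rewrite // ltnS leq_addl.
have vxy : logn p (x N * y N) = (a + b)%N by rewrite lognM // vx vy.
have xyN : (0 < x N * y N)%N by rewrite muln_gt0 xN.
split.
  rewrite -residueP /= modn_dvdm; last by rewrite dvdn_exp2l.
  by apply/eqP; rewrite -/(dvdn _ _) pfactor_dvdn // vxy.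
by apply/eqP; rewrite /= -/(dvdn _ _) pfactor_dvdn // vxy ltnn.
Qed.

Fact zp_integral x y : x * y = 0 -> (x == 0) || (y == 0).
Proof.
move=> xy; have [//|x0] := eqVneq x 0; have [//|y0] := eqVneq y 0.
have [_] := zp_valM_aux x0 y0.
by rewrite xy /= mod0n.
Qed.
HB.instance Definition _ := GRing.ComUnitRing_isIntegral.Build Zp zp_integral.

End PadicIntRing.

Section PadicField.
Variables (p : nat) (p_pr : prime p).
Notation Zp := (padic_int p_pr).
Local Open Scope ring_scope.

Definition padic := {fraction Zp}.
HB.instance Definition _ := GRing.Field.copy padic {fraction Zp}.

Section AbsoluteValue.
Variable K : numFieldType.

Definition zp_abs (x : Zp) : K :=
  if x == 0 then 0 else p%:R ^- zp_val x.

Definition padic_abs (x : padic) : K :=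
  zp_abs ((frac (repr x)).1) / zp_abs ((frac (repr x)).2).

Let pK_gt0 : 0 < p%:R :> K. Proof. by rewrite ltr0n prime_gt0. Qed.
Let pK_ge1 : 1 <= p%:R :> K. Proof. by rewrite ler1n prime_gt0. Qed.

Lemma zp_abs_ge0 x : 0 <= zp_abs x.
Proof.
by rewrite /zp_abs; case: eqP => // _; rewrite invr_ge0 exprn_ge0 // ltW.
Qed.

Lemma zp_abs_eq0 x : (zp_abs x == 0) = (x == 0).
Proof.
rewrite /zp_abs; have [//|x0] := eqVneq x 0; first by rewrite eqxx.
by rewrite invr_eq0 expf_eq0 (gt_eqF pK_gt0) andbF.
Qed.

Lemma zp_absM : {morph zp_abs : x y / x * y}.
Proof.
move=> x y; have [->|x0] := eqVneq x 0.
  by rewrite mul0r /zp_abs eqxx mul0r.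
have [->|y0] := eqVneq y 0; first by rewrite mulr0 /zp_abs eqxx mulr0.
rewrite /zp_abs mulf_eq0 (negPf x0) (negPf y0) /= -invfM -exprD.
by have [e1 e2] := zp_valM_aux x0 y0; rewrite (zp_valE e1 e2) addnC.
Qed.

Lemma zp_absN x : zp_abs (- x) = zp_abs x.
Proof.
have N1 : zp_abs (-1) ^+ 2 = 1.
  rewrite expr2 -zp_absM mulrNN mulr1 /zp_abs oner_eq0.
  by rewrite (@zp_valE _ _ 1 0) ?expr0 ?invr1 //= ?modn1 //
     expn1 modn_small ?prime_gt1.
have -> : - x = -1 * x by rewrite mulN1r.
rewrite zp_absM; suff -> : zp_abs (-1) = 1 by rewrite mul1r.
by apply/eqP; rewrite -(eqrXn2 (n := 2)) ?zp_abs_ge0 // N1 expr1n.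
Qed.

Lemma zp_abs_add_le x y c : zp_abs x <= c -> zp_abs y <= c ->
  zp_abs (x + y) <= c.
Proof.
have [->|x0] := eqVneq x 0; first by rewrite add0r.
have [->|y0] := eqVneq y 0; first by rewrite addr0.
have [->|xy0] := eqVneq (x + y) 0.
  by move=> + _; apply: le_trans; rewrite {1}/zp_abs eqxx zp_abs_ge0.
suff : (zp_val x <= zp_val (x + y)%R)%N \/ (zp_val y <= zp_val (x + y)%R)%N.
  have H u : u != 0 -> (zp_val u <= zp_val (x + y)%R)%N ->
      zp_abs (x + y) <= zp_abs u.
    move=> u0 uv; rewrite /zp_abs (negPf u0) (negPf xy0).
    by rewrite lef_pV2 ?posrE ?exprn_gt0 //; apply: ler_weXn2l.
  by move=> [/(H _ x0) H1 + _|/(H _ y0) H1 _]; apply: le_trans.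
rewrite !zp_val_le //.
have H k : x k = 0%N -> y k = 0%N -> (x + y) k = 0%N.
  by move=> xk yk; rewrite /= xk yk mod0n.
have [le|lt] := leqP (zp_val x) (zp_val y); [left|right];
  apply/eqP/H; apply/eqP; rewrite -zp_val_le //; exact: ltnW.
Qed.

Lemma padic_reprE (x : padic) :
  x = FracField.tofrac (frac (repr x)).1 / FracField.tofrac (frac (repr x)).2.
Proof.
have d0 : (frac (repr x)).2 != 0 := denom_ratioP _.
apply: (mulIf (x := FracField.tofrac (frac (repr x)).2)).
  by rewrite tofrac_eq0.
rewrite divfK ?tofrac_eq0 // -{1}[x]reprK; unlock FracField.tofrac.
rewrite -[LHS]FracField.pi_mul; apply/eqmodP.
rewrite /= FracField.equivfE /FracField.mulf.
by rewrite !numden_Ratio ?mulf_neq0 ?oner_eq0 // !mulr1 mulrC.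
Qed.

Lemma padic_fracE (x : padic) : exists a b : Zp,
  b != 0 /\ x = FracField.tofrac a / FracField.tofrac b.
Proof.
exists (frac (repr x)).1, (frac (repr x)).2; split; first exact: denom_ratioP.
exact: padic_reprE.
Qed.

Lemma padic_absE (a b : Zp) : b != 0 ->
  padic_abs (FracField.tofrac a / FracField.tofrac b) = zp_abs a / zp_abs b.
Proof.
move=> b0; pose x : padic := FracField.tofrac a / FracField.tofrac b.
rewrite /padic_abs -/x; set r := repr x.
have d0 : (frac r).2 != 0 := denom_ratioP r.
have e : a * (frac r).2 = (frac r).1 * b.
  apply/eqP; rewrite -tofrac_eq !tofracM; apply/eqP.
  have : x * FracField.tofrac b = FracField.tofrac a.
    by rewrite divfK ?tofrac_eq0.
  by move=> <-; rewrite [x]padic_reprE -/r mulrAC divfK ?tofrac_eq0.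
by apply/eqP; rewrite eqr_div ?zp_abs_eq0 // -!zp_absM e.
Qed.

Lemma padic_abs_ge0 x : 0 <= padic_abs x.
Proof. by rewrite divr_ge0 ?zp_abs_ge0. Qed.

Lemma padic_abs0 : padic_abs 0 = 0.
Proof.
have -> : 0 = FracField.tofrac 0 / FracField.tofrac 1 :> padic.
  by rewrite tofrac0 mul0r.
by rewrite padic_absE ?oner_eq0 // /zp_abs eqxx mul0r.
Qed.

Lemma padic_abs_eq0 x : padic_abs x = 0 -> x = 0.
Proof.
have [a [b [b0 ->]]] := padic_fracE x.
rewrite padic_absE // => /eqP; rewrite mulf_eq0 invr_eq0 !zp_abs_eq0.
by rewrite (negPf b0) orbF => /eqP->; rewrite tofrac0 mul0r.
Qed.

Lemma padic_absM : {morph padic_abs : x y / x * y}.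
Proof.
move=> x y; have [a [b [b0 ->]]] := padic_fracE x.
have [c [d [d0 ->]]] := padic_fracE y.
rewrite mulf_div -!tofracM !padic_absE ?mulf_neq0 //.
by rewrite mulf_div !zp_absM.
Qed.

Lemma padic_absN x : padic_abs (- x) = padic_abs x.
Proof.
have [a [b [b0 ->]]] := padic_fracE x.
by rewrite -mulNr -tofracN !padic_absE // zp_absN.
Qed.

Lemma padic_abs_add_le x y c : padic_abs x <= c -> padic_abs y <= c ->
  padic_abs (x + y) <= c.
Proof.
have [a [b [b0 ->]]] := padic_fracE x.
have [a' [b' [b'0 ->]]] := padic_fracE y.
have abs_gt0 (u : Zp) : u != 0 -> 0 < zp_abs u.
  by move=> u0; rewrite lt_neqAle zp_abs_ge0 eq_sym zp_abs_eq0 u0.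
rewrite addf_div ?tofrac_eq0 // -!(tofracM, tofracD).
rewrite !padic_absE ?mulf_neq0 // !ler_pdivrMr ?abs_gt0 ?mulf_neq0 //.
move=> ab a'b'; apply: zp_abs_add_le; rewrite !zp_absM ?mulrA.
  by rewrite ler_pM2r ?abs_gt0.
by rewrite mulrAC ler_pM2r ?abs_gt0.
Qed.

End AbsoluteValue.

(* |.|_p takes rational values, so that the metric of Q_p does not depend on a
   choice of real numbers. *)
Definition padic_dist (x y : padic) : rat := padic_abs rat (x - y).

Fact padic_distxx x : padic_dist x x = 0.
Proof. by rewrite /padic_dist subrr padic_abs0. Qed.
Fact padic_dist_eq0 x y : padic_dist x y = 0 -> x = y.
Proof. by move=> /padic_abs_eq0 /subr0_eq. Qed.
Fact padic_distC x y : padic_dist x y = padic_dist y x.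
Proof. by rewrite /padic_dist -padic_absN opprB. Qed.
Fact padic_dist_triangle y x z :
  padic_dist x z <= padic_dist x y + padic_dist y z.
Proof.
rewrite /padic_dist -(subrKA y); apply: padic_abs_add_le.
  by rewrite lerDl padic_abs_ge0.
by rewrite lerDr padic_abs_ge0.
Qed.

HB.instance Definition _ := isPointed.Build padic 0.
HB.instance Definition _ := isMetric.Build rat padic
  padic_distxx padic_dist_eq0 padic_distC padic_dist_triangle.
End PadicField.

Section Quasielliptic.
Local Open Scope ring_scope.
Variables (p : nat) (p_pr : prime p) (n : nat).
Notation Qp := (padic p_pr).
Notation Qpn := 'rV[padic p_pr]_n.

Definition padic_integer (x : Qp) : Prop :=
  exists a : padic_int p_pr, x = FracField.tofrac a.

Definition padic_eval (f : mpoly.mpoly n Qp) (xi : Qpn) : Qp :=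
  mpoly.meval (fun i => xi ord0 i) f.

Definition quasielliptic (f : mpoly.mpoly n Qp) (d : nat) (w : 'I_n -> nat) :
    Prop :=
  [/\ forall c : Qp, f <> mpoly.mpolyC n c,
      forall i, (0 < w i)%N,
      forall (lambda : Qp) (xi : Qpn), lambda != 0 ->
        padic_eval f (\row_i (lambda ^+ w i * xi ord0 i)) =
        lambda ^+ d * padic_eval f xi &
      forall xi : Qpn, padic_eval f xi = 0 <-> xi = 0].

Definition padic_integer_coeffs (f : mpoly.mpoly n Qp) : Prop :=
  forall m, padic_integer (mpoly.mcoeff m f).

End Quasielliptic.

Section FunctionSpaces.
Local Open Scope classical_set_scope.
Local Open Scope ring_scope.
Variables (R : realType) (p : nat) (p_pr : prime p) (n : nat).
Notation Qp := (padic p_pr).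
Notation Qpn := 'rV[padic p_pr]_n.
Notation C := R[i].

Definition padic_norm (x : Qpn) : R :=
  \big[Num.max/0]_(i < n) padic_abs R (x ord0 i).

(* {x}_p is the only a / p ^ m in [0, 1) with x - a / p ^ m in Z_p. *)
Definition padic_frac (x : Qp) : R :=
  xget 0 [set q | exists a m : nat, [/\ (a < p ^ m)%N,
    q = a%:R / p%:R ^+ m & padic_integer (x - a%:R / p%:R ^+ m)]].

Definition padic_char (x : Qp) : C :=
  Complex (cos (2 * pi * padic_frac x)) (sin (2 * pi * padic_frac x)).

Definition padic_dot (x y : Qpn) : Qp := \sum_(i < n) x ord0 i * y ord0 i.

Notation borel := (g_sigma_algebraType (@open Qpn)).

Definition normalized_haar (mu : {measure set borel -> \bar R}) : Prop :=
  (forall (x : Qpn) (A : set borel), measurable A ->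
     mu [set (x + y : Qpn) | y in A] = mu A) /\
  mu [set x : Qpn | forall i, padic_integer (x ord0 i)] = 1%E.

Definition schwartz_bruhat (phi : Qpn -> C) : Prop :=
  (forall x, \forall y \near x, phi y = phi x) /\
  compact (closure [set x | phi x != 0]).

Definition cmeasurable (u : Qpn -> C) : Prop :=
  measurable_fun [set: borel] (fun x : borel => complex.Re (u x) : R) /\
  measurable_fun [set: borel] (fun x : borel => complex.Im (u x) : R).

Variable mu : {measure set borel -> \bar R}.

Definition cintegral (u : Qpn -> C) : C :=
  Complex (\int[mu]_x complex.Re (u x)) (\int[mu]_x complex.Im (u x)).

Definition fourier (phi : Qpn -> C) (xi : Qpn) : C :=
  cintegral (fun x => padic_char (- padic_dot x xi) * phi x).

Definition fourier_inv (g : Qpn -> C) (x : Qpn) : C :=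
  cintegral (fun xi => padic_char (padic_dot x xi) * g xi).

Definition L2sqdist (weight : Qpn -> R) (u v : Qpn -> C) : \bar R :=
  \int[mu]_x ((weight x * Normc.normc (u x - v x) ^+ 2)%:E)%E.

(* The graph of the unitary extension of the Fourier transform from S to L^2. *)
Definition L2_fourier (u v : Qpn -> C) : Prop :=
  [/\ cmeasurable u, cmeasurable v & exists phi : nat -> Qpn -> C,
    [/\ forall k, schwartz_bruhat (phi k),
        L2sqdist (cst 1) (phi k) u @[k --> \oo] --> 0%E &
        L2sqdist (cst 1) (fourier (phi k)) v @[k --> \oo] --> 0%E]].

Variables (w : 'I_n -> nat) (d : nat).

Definition Xi (xi : Qpn) : R :=
  \sum_(i < n) padic_abs R (xi ord0 i) `^ (d%:R / (w i)%:R).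

Definition Phi (phi : Qpn -> C) : Prop :=
  schwartz_bruhat phi /\ fourier phi 0 = 0.

(* An element of the completion of Phi for ||.||_beta is represented by its
   Fourier transform v, the limit in L^2(Xi^(2 beta)) of the transforms of a
   sequence of elements of Phi. *)
Definition Htilde (beta : R) (v : Qpn -> C) : Prop :=
  cmeasurable v /\ exists phi : nat -> Qpn -> C,
    (forall k, Phi (phi k)) /\
    L2sqdist (fun xi => Xi xi `^ (2 * beta)) (fourier (phi k)) v
      @[k --> \oo] --> 0%E.

(* As Htilde 0 is L^2, the elements of the intersection are genuine functions u
   on Q_p^n, related to their representative v by the L^2 Fourier transform. *)
Definition Htilde_infty (u : Qpn -> C) : Prop :=
  exists v, L2_fourier u v /\ forall beta : nat, Htilde beta%:R v.

Definition Omega (l : int) (x : Qpn) : R :=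
  if padic_norm x <= p%:R ^ l then 1 else 0.

Definition heat_symbol (f : mpoly.mpoly n Qp) (alpha t : R) (xi : Qpn) : R :=
  expR (- t * padic_abs R (padic_eval f xi) `^ alpha).

Definition varphi (f : mpoly.mpoly n Qp) (alpha : R) (r : nat) (t : R) :
    Qpn -> C :=
  fourier_inv (fun xi =>
    ((1 - Omega (- r%:Z) xi) * heat_symbol f alpha t xi)%:C%C).

Definition heat_kernel (f : mpoly.mpoly n Qp) (alpha t : R) (x : Qpn) : C :=
  cintegral (fun xi =>
    padic_char (padic_dot x xi) * (heat_symbol f alpha t xi)%:C%C).

End FunctionSpaces.

(* Main.v *)
(* Away from the origin |f|_p is locally constant, hence so is the symbol g
   (either e^{-t|f|^alpha} or its product with 1 - Omega_{-r}).  Its truncations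
   g_k to the annuli p^-k < ||x||_p <= p^k are therefore finite combinations of
   indicators of cosets of a ball; they vanish at 0, and Fourier inversion and
   Plancherel's identity for them only involve character sums over balls.
   Compactness of the unit ball and quasi-homogeneity give
   |f(x)|_p >= c p^(s d), where s is the least integer with
   |x_i|_p <= p^(s w_i) for all i, so that Xi^b e^{-t|f|^alpha} is integrable
   for every b.  By dominated convergence g_k tends to g in every weighted L^2
   space and F^-1 g_k tends to F^-1 g pointwise; Fatou's lemma and Plancherel's
   identity turn the latter into L^2 convergence. *)
Require Import Defs.
From mathcomp Require Import all_boot all_order all_algebra.
From mathcomp Require Import fraction complex.
From mathcomp Require mpoly.
From mathcomp Require Import all_classical all_reals all_analysis.
From mathcomp Require Import measurable_realfun ring lra.

Set Implicit Arguments.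
Unset Strict Implicit.
Unset Printing Implicit Defensive.

Import Order.TTheory GRing.Theory Num.Theory.
Import numFieldNormedType.Exports.
Local Open Scope ring_scope.

(** * Divisibility in Z_p and the absolute value of Q_p *)

Section PadicArithmetic.
Variables (p : nat) (p_pr : prime p).
Notation Zp := (padic_int p_pr).
Notation Qp := (padic p_pr).

(** F^-1 g is given by a pointwise integral, whereas [L2_fourier] asks for an L^2 limit of test
    functions. That the F^-1 g_k are Cauchy in L^2 would not name their limit; Fatou does, because
    |g_k - g_j| <= |g_k - g| for all j >= k, a bound uniform in j. The same sequence then serves the
    L^2 relation and every weight, and beta = 0 controls the former. The annuli have an inner radius
    for two reasons: the heat symbol is not locally constant at the origin, and [Phi] requires
    transforms that vanish there. The price is that g_k may fail to converge to g at the origin,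
    which is a null set because n > 0 (a non-constant polynomial has a variable). The level s is
    taken in the natural numbers: on the region s = 0, which contains the zero of f, no lower bound
    for |f| is possible and g <= 1 suffices. Points of level s lie in the ball of radius p^(s W), W
    being the sum of the weights, of volume p^(s W n); decay by p^-(s (W n + 1)) thus leaves a
    geometric series. *)

Lemma zp_natE (a k : nat) : (a%:R : Zp) k = (a %% p ^ k)%N.
Proof.
elim: a => [|a IH]; first by rewrite /= mod0n.
by rewrite -addn1 natrD /= IH modnDml modnDmr.
Qed.

Lemma zp_subr_eq (x y : Zp) k : (x k == y k) = ((x - y) k == 0%N).
Proof.
apply/eqP/eqP => [e|e].
  by rewrite /= e modnDmr subnKC ?modnn // ltnW ?residue_lt.
have -> : x k = ((x - y) + y) k by rewrite subrK.
have -> : ((x - y) + y) k = (((x - y)%R k + y k) %% p ^ k)%N by [].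
by rewrite e residue_mod.
Qed.

(** Valuations add, so multiplication by [b] shifts divisibility by exactly [zp_val b] places. This
    cancellation law makes quotients by [b] unique modulo p^k. *)
Lemma zp_mul_res (b z : Zp) k : b != 0 ->
  ((b * z) (k + zp_val b)%N == 0%N) = (z k == 0%N).
Proof.
move=> b0; have [->|z0] := eqVneq z 0; first by rewrite mulr0 /= !mod0n.
have bz0 : b * z != 0 by rewrite mulf_neq0.
rewrite -!zp_val_le //; have [e1 e2] := zp_valM_aux b0 z0.
by rewrite (zp_valE e1 e2) addnC leq_add2l.
Qed.

(** Bezout: with v = [zp_val b], the gcd of [b] and p^(k + v) is p^v, so a multiple of [b] is
    congruent to p^v; multiply it by a / p^v. *)
Lemma zp_solve (b : Zp) (a k : nat) : b != 0 ->
  (p ^ zp_val b %| a)%N ->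
  exists c : nat, (b * c%:R) (k + zp_val b)%N = (a%:R : Zp) (k + zp_val b)%N.
Proof.
move=> b0 /dvdnP[a' ->]; set v := zp_val b.
case: k => [|k].
  by exists 0%N; rewrite add0n mulr0 /= mod0n zp_natE modnMl.
have [bk0 bk] : (0 < b (k.+1 + v)%N)%N /\ logn p (b (k.+1 + v)%N) = v.
  by apply: zp_logn; rewrite // addSn ltnS leq_addl.
have g : gcdn (b (k.+1 + v)%N) (p ^ (k.+1 + v)) = (p ^ v)%N.
  have/(dvdn_pfactor _ _ p_pr)[m mle e] :
    (gcdn (b (k.+1 + v)%N) (p ^ (k.+1 + v)) %| p ^ (k.+1 + v))%N by exact: dvdn_gcdr.
  apply/eqP; rewrite eqn_dvd; apply/andP; split; last first.
    by rewrite dvdn_gcd pfactor_dvdn // bk leqnn dvdn_exp2l // leq_addl.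
  by rewrite e dvdn_exp2l // -bk -pfactor_dvdn // -e; exact: dvdn_gcdl.
case: (egcdnP (p ^ (k.+1 + v)) bk0) => km kn e _.
exists (km * a')%N; rewrite /= !zp_natE modnMmr.
by rewrite [(km * a')%N]mulnC mulnCA [(_ * km)%N]mulnC e g mulnDr mulnA modnMDl.
Qed.

(** The equation is solved modulo each p^(k + v), v = [zp_val b]. By [zp_mul_res] a solution is
    unique modulo p^k, so the solutions are compatible and define a point of the inverse limit. *)
Lemma zp_dvd (a b : Zp) : b != 0 -> a (zp_val b) = 0%N ->
  exists c : Zp, a = b * c.
Proof.
move=> b0 av.
have sol k : exists c : nat, (b * c%:R) (k + zp_val b)%N = a (k + zp_val b)%N.
  have /(zp_solve k b0)[c e] : (p ^ zp_val b %| a (k + zp_val b))%N.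
    by have := residue_le a (leq_addl k (zp_val b)); rewrite av => /eqP.
  by exists c; rewrite e zp_natE residue_mod.
have [c cP] := choice sol.
have cS k : c k.+1 = c k %[mod p ^ k].
  rewrite -!zp_natE; apply/eqP; rewrite zp_subr_eq -(zp_mul_res _ _ b0) mulrBr.
  rewrite -zp_subr_eq cP -(residueP _ (k + zp_val b)).
  by rewrite -addSn cP addSn residueP.
exists (mk_padic_int p_pr cS); apply: padic_int_eq => k.
rewrite -(residue_le a (leq_addr (zp_val b) k)) -cP.
rewrite -(residue_le (b * _) (leq_addr (zp_val b) k)); congr (_ %% _)%N.
apply/eqP; rewrite zp_subr_eq -mulrBr zp_mul_res // -zp_subr_eq.
by rewrite zp_natE.
Qed.

Section Abs.
Variable K : numFieldType.
Notation abs := (@padic_abs p p_pr K).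

Let pK_gt0 : 0 < p%:R :> K. Proof. by rewrite ltr0n prime_gt0. Qed.
Let pK_gt1 : 1 < p%:R :> K. Proof. by rewrite ltr1n prime_gt1. Qed.

Lemma zp_abs_le (x : Zp) k : (zp_abs K x <= p%:R ^- k) = (x k == 0%N).
Proof.
rewrite /zp_abs; have [->|x0] := eqVneq x 0.
  by rewrite /= mod0n eqxx invr_ge0 exprn_ge0 // ltW.
rewrite lef_pV2 ?posrE ?exprn_gt0 // ler_eXn2l //.
exact: zp_val_le.
Qed.

Lemma zp_abs_gt0 (x : Zp) : x != 0 -> 0 < zp_abs K x.
Proof. by move=> x0; rewrite lt_neqAle zp_abs_ge0 eq_sym zp_abs_eq0 x0. Qed.

Lemma padic_abs_tofrac (a : Zp) : abs (FracField.tofrac a) = zp_abs K a.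
Proof.
have -> : FracField.tofrac a = FracField.tofrac a / FracField.tofrac 1.
  by rewrite tofrac1 divr1.
rewrite padic_absE ?oner_eq0 //.
rewrite {2}/zp_abs oner_eq0 (@zp_valE _ _ 1 0) ?expr0 ?invr1 ?mulr1 //= ?modn1 //.
by rewrite expn1 modn_small ?prime_gt1.
Qed.

(** Links the algebraic Z_p of the Haar normalization and of [padic_frac] with the unit ball. For
    the converse, |a| <= |b| says that p^(val b) divides [a], and then [b] divides [a]. *)
Lemma padic_integerP (x : Qp) : padic_integer x <-> abs x <= 1.
Proof.
split=> [[a ->]|].
  rewrite padic_abs_tofrac -[leRHS]invr1 -(expr0 p%:R) zp_abs_le.
  by have := residue_lt a 0; rewrite expn0 ltnS leqn0.
have [a [b [b0 ->]]] := padic_fracE x.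
rewrite padic_absE // ler_pdivrMr ?zp_abs_gt0 // mul1r => ab.
have [|c ->] := @zp_dvd a b b0; last first.
  by exists c; rewrite tofracM mulrC mulKf ?tofrac_eq0.
apply/eqP; rewrite -zp_abs_le (le_trans ab) // {1}/zp_abs.
by rewrite (negPf b0).
Qed.

Lemma padic_abs_nat_le (a k : nat) : (abs (a%:R : Qp) <= p%:R ^- k) = (p ^ k %| a)%N.
Proof.
have -> : a%:R = FracField.tofrac (a%:R : Zp) :> Qp.
  by rewrite rmorph_nat.
by rewrite padic_abs_tofrac zp_abs_le zp_natE.
Qed.

Lemma padic_abs1 : abs (1 : Qp) = 1.
Proof.
have : abs (1 : Qp) * abs (1 : Qp) = abs (1 : Qp) * 1 by rewrite -padic_absM !mulr1.
by apply: mulfI; apply/eqP => /padic_abs_eq0/eqP; rewrite oner_eq0.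
Qed.

Lemma padic_absV : {morph abs : x / x^-1}.
Proof.
move=> x; have [->|x0] := eqVneq x 0; first by rewrite invr0 padic_abs0 invr0.
have ax : abs x != 0.
  by apply/eqP => /padic_abs_eq0/eqP; rewrite (negPf x0).
by apply: (mulfI ax); rewrite -padic_absM !mulfV // padic_abs1.
Qed.

Lemma padic_absX x k : abs (x ^+ k) = abs x ^+ k.
Proof.
elim: k => [|k IH]; first by rewrite !expr0 padic_abs1.
by rewrite !exprS padic_absM IH.
Qed.

Lemma padic_abs_prime : abs (p%:R : Qp) = p%:R^-1.
Proof.
have p0 : (p%:R : Zp) != 0.
  apply/eqP => /(congr1 (fun x => residue x 2)) /eqP.
  rewrite zp_natE /= mod0n modn_small ?eqn0Ngt ?prime_gt0 //.
  by rewrite expnS expn1 ltn_Pmulr ?prime_gt1 ?prime_gt0.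
have -> : p%:R = FracField.tofrac (p%:R : Zp) :> Qp by rewrite rmorph_nat.
rewrite padic_abs_tofrac /zp_abs (negPf p0) (@zp_valE _ _ _ 1) ?expr1 //.
  by rewrite zp_natE expn1 modnn.
rewrite zp_natE modn_small; last by rewrite expnS expn1 ltn_Pmulr ?prime_gt1 ?prime_gt0.
by have := prime_gt0 p_pr; case: (p).
Qed.

Lemma padic_absB_le x y c : abs x <= c -> abs y <= c -> abs (x - y) <= c.
Proof. by move=> xc yc; apply: padic_abs_add_le => //; rewrite padic_absN. Qed.

(** If |x + y| were smaller than |x|, then x = (x + y) - y would be bounded by something smaller
    than |x|. This is what makes absolute values locally constant away from zero. *)
Lemma padic_absD_eq x y : abs y < abs x -> abs (x + y) = abs x.
Proof.
move=> yx; apply/le_anti/andP; split; first exact: padic_abs_add_le (lexx _) (ltW yx).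
(* The order of [K] is only partial; absolute values are comparable because they are nonnegative,
   hence real. *)
have [|h] := real_leP (ger0_real (padic_abs_ge0 K x)) (ger0_real (padic_abs_ge0 K (x + y))) => //.
have [c [c1 c2 c3]] : exists c, [/\ abs y <= c, abs (x + y) <= c & c < abs x].
  by case: (real_leP (ger0_real (padic_abs_ge0 K y)) (ger0_real (padic_abs_ge0 K (x + y)))) => h';
   [exists (abs (x + y))|exists (abs y)]; split => //; apply: ltW.
by have := padic_absB_le c2 c1; rewrite addrK => /le_lt_trans/(_ c3); rewrite ltxx.
Qed.

Lemma padic_abs_val x : x != 0 -> exists z : int, abs x = p%:R ^ z.
Proof.
have [a [b [b0 ->]]] := padic_fracE x.
rewrite mulf_eq0 tofrac_eq0 negb_or => /andP[a0 _].
exists ((zp_val b)%:Z - (zp_val a)%:Z).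
rewrite padic_absE // /zp_abs (negPf a0) (negPf b0) invrK mulrC.
by rewrite expfzDr ?gt_eqF // exprnN.
Qed.

End Abs.

(** The metric of Q_p is rational-valued and the analysis real-valued; this carries inequalities
    from one to the other. *)
Lemma padic_abs_ratr (K : numFieldType) (x : Qp) :
  padic_abs K x = ratr (padic_abs rat x).
Proof.
have [a [b [b0 ->]]] := padic_fracE x.
have H (u : Zp) : zp_abs K u = ratr (zp_abs rat u).
  rewrite /zp_abs; case: ifP => _; first by rewrite rmorph0.
  by rewrite fmorphV rmorphXn rmorph_nat.
by rewrite !padic_absE // fmorph_div !H.
Qed.

End PadicArithmetic.

(** Pigeonhole principle, applied below to the residue classes modulo p^k. *)
Lemma ultra_bigcup_nat (T : Type) (F : set_system T) (A : nat -> set T) N :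
  UltraFilter F -> F (\bigcup_(a in `I_N) A a)%classic ->
  exists2 a, (a < N)%N & F (A a).
Proof.
move=> FU; elim: N => [|N IH].
  by rewrite II0 bigcup_set0 => /filter_ex[].
rewrite IIS bigcup_setU bigcup_set1 => FA.
have [FN|FN] := in_ultra_setVsetC (A N) FU; first by exists N.
have [|a aN Fa] := IH; last by exists a => //; rewrite ltnS ltnW.
by apply: filterS2 FA FN => x /= [].
Qed.

Lemma natr_expN_lt (K : archiRealFieldType) (q : nat) (e : K) :
  (1 < q)%N -> 0 < e -> exists k, q%:R ^- k < e.
Proof.
move=> q1 e0; exists (Num.bound e^-1).
have q0 : 0 < q%:R :> K by rewrite ltr0n ltnW.
rewrite -[ltRHS]invrK ltf_pV2 ?posrE ?exprn_gt0 ?invr_gt0 //.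
have := @archi_boundP K e^-1; rewrite invr_ge0 ltW // => /(_ isT) /lt_le_trans; apply.
by rewrite -natrX ler_nat ltnW // ltn_expl.
Qed.

(** * Topology of Q_p and Q_p^n: neighbourhoods, norm, compact balls *)

Section PadicTopology.
Local Open Scope classical_set_scope.
Variables (R : realType) (p : nat) (p_pr : prime p).
Notation Zp := (padic_int p_pr).
Notation Qp := (padic p_pr).
Notation abs := (@padic_abs p p_pr R).

Let pR_gt0 : 0 < p%:R :> R. Proof. by rewrite ltr0n prime_gt0. Qed.
Let pR_gt1 : 1 < p%:R :> R. Proof. by rewrite ltr1n prime_gt1. Qed.

Lemma padic_abs_lt_ratr (x : Qp) (e : rat) :
  (padic_abs rat x < e) = (abs x < ratr e).
Proof. by rewrite (padic_abs_ratr R) ltr_rat. Qed.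

Lemma nbhs_padic (x : Qp) (A : set Qp) :
  nbhs x A <-> exists k : nat, forall y, abs (y - x) <= p%:R ^- k -> A y.
Proof.
rewrite (@nbhs_ballP rat Qp); split=> [[e /= e0 eA]|[k kA]].
  have [k ke] := natr_expN_lt (prime_gt1 p_pr) e0.
  exists k => y yx; apply: eA; rewrite ballEmdist /=.
  rewrite /mdist /= /padic_dist -padic_absN opprB padic_abs_lt_ratr.
  by rewrite (le_lt_trans yx) // -(ratr_nat R) -rmorphXn -fmorphV ltr_rat.
exists (p%:R ^- k); first by rewrite /= invr_gt0 exprn_gt0 // ltr0n prime_gt0.
move=> y; rewrite ballEmdist /= /mdist /= /padic_dist -padic_absN opprB.
by rewrite padic_abs_lt_ratr fmorphV rmorphXn rmorph_nat => /ltW /kA.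
Qed.

(** An ultrafilter on Z_p selects one residue class modulo each p^k. Two selected classes meet, so
    the residues are compatible; the p-adic integer that they define is the limit. *)
Lemma compact_padic_integers : compact [set x : Qp | abs x <= 1].
Proof.
rewrite compact_ultra => F FU F1.
have sol k : exists2 a : nat, (a < p ^ k)%N &
    F [set x | abs (x - a%:R) <= p%:R ^- k].
  apply: ultra_bigcup_nat; apply: filterS F1 => x /= /padic_integerP[z ->].
  exists (z k); first exact: residue_lt.
  have -> : ((z k)%:R : Qp) = FracField.tofrac ((z k)%:R : Zp).
    by rewrite rmorph_nat.
  by rewrite /= -rmorphB padic_abs_tofrac zp_abs_le -zp_subr_eq zp_natE residue_mod.
have [a aF] : exists a : nat -> nat,
    forall k, F [set x | abs (x - (a k)%:R) <= p%:R ^- k].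
  have /choice[a aF] : forall k, exists a : nat,
      F [set x | abs (x - a%:R) <= p%:R ^- k].
    by move=> k; have [a _ aF] := sol k; exists a.
  by exists a.
have aS k : a k.+1 = a k %[mod p ^ k].
  have /filter_ex[x /= [x1 x2]] : F ([set x | abs (x - (a k)%:R) <= p%:R ^- k] `&`
      [set x | abs (x - (a k.+1)%:R) <= p%:R ^- k.+1]) by exact: filterI.
  have {}x2 : abs (x - (a k.+1)%:R) <= p%:R ^- k.
    by rewrite (le_trans x2) // lef_pV2 ?posrE ?exprn_gt0 // ler_eXn2l.
  have := padic_absB_le x1 x2; rewrite opprB addrC subrKA.
  have -> : ((a k.+1)%:R - (a k)%:R : Qp) =
     FracField.tofrac ((a k.+1)%:R - (a k)%:R : Zp) by rewrite rmorphB !rmorph_nat.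
  by rewrite padic_abs_tofrac zp_abs_le -zp_subr_eq !zp_natE => /eqP.
pose l := mk_padic_int p_pr aS.
have la k : abs (FracField.tofrac l - (a k)%:R) <= p%:R ^- k.
  have -> : ((a k)%:R : Qp) = FracField.tofrac ((a k)%:R : Zp).
    by rewrite rmorph_nat.
  by rewrite -rmorphB padic_abs_tofrac zp_abs_le -zp_subr_eq zp_natE.
exists (FracField.tofrac l); split.
  by apply/padic_integerP; exists l.
move=> A /nbhs_padic[k kA]; apply: filterS (aF k) => x /= xa; apply: kA.
by rewrite -(subrKA (a k)%:R); apply: padic_abs_add_le; rewrite // -padic_absN opprB.
Qed.

Variable n : nat.
Notation Qpn := 'rV[padic p_pr]_n.
Notation norm := (@padic_norm R p p_pr n).
Implicit Types x y : Qpn.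

Lemma padic_norm_leP x c : 0 <= c ->
  norm x <= c <-> forall i, abs (x ord0 i) <= c.
Proof.
move=> c0; split=> [/bigmax_leP[_ H] i|H]; first exact: H.
by apply/bigmax_leP; split.
Qed.

Lemma padic_norm_ge0 x : 0 <= norm x.
Proof. exact: bigmax_ge_id. Qed.

Lemma padic_abs_le_norm x i : abs (x ord0 i) <= norm x.
Proof. exact: (padic_norm_leP x (padic_norm_ge0 x)).1. Qed.

Lemma padic_norm0 : norm 0 = 0.
Proof.
apply/le_anti; rewrite padic_norm_ge0 andbT; apply/padic_norm_leP => // i.
by rewrite mxE padic_abs0.
Qed.

Lemma padic_norm_eq0 x : norm x = 0 -> x = 0.
Proof.
move=> x0; apply/rowP => i; rewrite mxE; apply: (@padic_abs_eq0 _ _ R).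
by apply/le_anti; rewrite padic_abs_ge0 andbT (le_trans (padic_abs_le_norm _ _)) ?x0.
Qed.

Lemma padic_norm_gt0 x : x != 0 -> 0 < norm x.
Proof.
move=> x0; rewrite lt_neqAle padic_norm_ge0 andbT eq_sym.
by apply: contra_neq x0 => /padic_norm_eq0.
Qed.

Lemma padic_normN x : norm (- x) = norm x.
Proof. by apply: eq_bigr => i _; rewrite mxE padic_absN. Qed.

Lemma padic_normD_le x y c : norm x <= c -> norm y <= c -> norm (x + y) <= c.
Proof.
move=> xc yc; have c0 := le_trans (padic_norm_ge0 x) xc.
apply/padic_norm_leP => // i; rewrite mxE.
by apply: padic_abs_add_le; apply: le_trans (padic_abs_le_norm _ _) _.
Qed.

Lemma padic_normB_le x y c : norm x <= c -> norm y <= c -> norm (x - y) <= c.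
Proof. by move=> xc yc; apply: padic_normD_le; rewrite ?padic_normN. Qed.

Lemma padic_norm_shift x y c : norm y <= c -> (norm (x + y) <= c) = (norm x <= c).
Proof.
move=> yc; apply/idP/idP => xc; last exact: padic_normD_le.
by rewrite -(addrK y x) padic_normB_le.
Qed.

Lemma padic_normD_eq x y : norm y < norm x -> norm (x + y) = norm x.
Proof.
move=> yx; apply/le_anti; rewrite padic_normD_le ?(ltW yx) //=.
rewrite leNgt; apply/negP => h.
have : norm x <= Num.max (norm (x + y)) (norm y).
  by rewrite -{1}(addrK y x) padic_normB_le // le_max lexx ?orbT.
by rewrite le_max leNgt h /= leNgt yx.
Qed.

Lemma nbhs_padic_row x (A : set Qpn) :
  nbhs x A <-> exists k : nat, forall y, norm (y - x) <= p%:R ^- k -> A y.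
Proof.
rewrite (@nbhs_ballP rat Qpn); split=> [[e /= e0 eA]|[k kA]].
  have [k ke] := natr_expN_lt (prime_gt1 p_pr) e0.
  exists k => y yx; apply: eA; split => // i j; rewrite ballEmdist /=.
  rewrite /mdist /= /padic_dist -padic_absN opprB padic_abs_lt_ratr.
  have := padic_abs_le_norm (y - x) j; rewrite !mxE (ord1 i) => h.
  rewrite (le_lt_trans h) // (le_lt_trans yx) //.
  by rewrite -(ratr_nat R) -rmorphXn -fmorphV ltr_rat.
exists (p%:R ^- k); first by rewrite /= invr_gt0 exprn_gt0 // ltr0n prime_gt0.
move=> y [_ xy]; apply: kA; apply/padic_norm_leP => [|i].
  by rewrite invr_ge0 exprn_ge0 // ltW.
move: (xy ord0 i); rewrite ballEmdist /= /mdist /= /padic_dist -padic_absN opprB.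
by rewrite padic_abs_lt_ratr fmorphV rmorphXn rmorph_nat !mxE => /ltW.
Qed.

Definition padic_ball (c : R) : set Qpn := [set x | norm x <= c].

Lemma padic_prime_neq0 : p%:R != 0 :> Qp.
Proof.
apply/eqP => /(congr1 abs)/eqP.
by rewrite padic_abs_prime padic_abs0 invr_eq0 gt_eqF.
Qed.

Lemma padic_abs_primeXN k : abs (p%:R ^- k) = p%:R ^+ k.
Proof. by rewrite padic_absV padic_absX padic_abs_prime exprVn invrK. Qed.

Lemma padic_normZ (a : Qp) x : norm (a *: x) = abs a * norm x.
Proof.
rewrite /padic_norm [RHS]big_endo ?mulr0 //; last first.
  by move=> u v; rewrite maxr_pMr ?padic_abs_ge0.
by apply: eq_bigr => i _; rewrite mxE padic_absM.
Qed.

(** The unit ball is a product of copies of Z_p, compact by Tychonoff, and scaling by p^-k maps it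
    continuously onto the ball of radius p^k. *)
Lemma compact_padic_ball (k : nat) : compact (padic_ball (p%:R ^+ k)).
Proof.
have c1 := rV_compact (fun _ : 'I_n => compact_padic_integers).
have -> : padic_ball (p%:R ^+ k) =
  (fun x : Qpn => p%:R ^- k *: x) @` [set v : Qpn | forall i, abs (v ord0 i) <= 1].
  have pk0 : p%:R ^- k != 0 :> Qp by rewrite invr_eq0 expf_neq0 ?padic_prime_neq0.
  apply/seteqP; split=> [x /= xk|_ /= [x /padic_norm_leP x1 <-]]; last first.
    rewrite /padic_ball /= padic_normZ padic_abs_primeXN.
    by rewrite ger_pMr ?exprn_gt0 // x1.
  exists (p%:R ^+ k *: x); last by rewrite scalerA mulVf ?scale1r // -invr_eq0.
  apply/padic_norm_leP => //; rewrite padic_normZ padic_absX padic_abs_prime.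
  by rewrite exprVn mulrC ler_pdivrMr ?exprn_gt0 // mul1r.
apply: continuous_compact => //; apply: continuous_subspaceT => x A.
move=> /nbhs_padic_row[j jA]; apply/nbhs_padic_row; exists (k + j)%N => y yx.
apply: jA; rewrite -scalerBr padic_normZ padic_abs_primeXN.
by rewrite mulrC -ler_pdivlMr ?exprn_gt0 // -invfM -exprD addnC.
Qed.
End PadicTopology.

(** * The additive character of Q_p *)

Section Character.
Variables (R : realType).
Notation C := R[i].

(** The character e^(2 pi i q) of R / Z. *)
Definition cis (q : R) : C := Complex (cos (2 * pi * q)) (sin (2 * pi * q)).

Lemma cisD q r : cis (q + r) = cis q * cis r.
Proof.
rewrite /cis mulrDr cosD sinD; simpc.
by congr Complex; rewrite addrC [cos _ * sin _]mulrC.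
Qed.

Lemma cis_nat (k : nat) : cis k%:R = 1.
Proof.
elim: k => [|k IH]; first by rewrite /cis mulr0 cos0 sin0.
by rewrite -addn1 natrD cisD IH mul1r /cis mulr1 mulr_natl cos2pi sin2pi.
Qed.

Lemma cis_conj q : (cis q)^*%C * cis q = 1.
Proof.
rewrite /cis /=; simpc; congr Complex; last by rewrite mulrC subrr.
by rewrite -!expr2 cos2Dsin2.
Qed.

(** For q >= 2 the angle 2 pi / q lies in [0, pi], where the cosine is injective. *)
Lemma cis_inv_neq1 (q : nat) : (1 < q)%N -> cis q%:R^-1 <> 1.
Proof.
move=> q1 [e _]; have q0 : 0 < q%:R :> R by rewrite ltr0n ltnW.
have : 2 * pi / q%:R = 0 :> R.
  apply: cos_inj; rewrite ?cos0 //.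
    rewrite in_itv /= divr_ge0 ?mulr_ge0 ?pi_ge0 ?(ltW q0) //=.
    by rewrite ler_pdivrMr // mulrC ler_wpM2l ?pi_ge0 // ler_nat.
  by rewrite in_itv /= lexx pi_ge0.
by move/eqP; rewrite !mulf_eq0 invr_eq0 !gt_eqF ?pi_gt0.
Qed.

Variables (p : nat) (p_pr : prime p).
Notation Zp := (padic_int p_pr).
Notation Qp := (padic p_pr).
Notation abs := (@padic_abs p p_pr R).
Notation chi := (@padic_char R p p_pr).

Let pR_gt0 : 0 < p%:R :> R. Proof. by rewrite ltr0n prime_gt0. Qed.
Let pR_gt1 : 1 < p%:R :> R. Proof. by rewrite ltr1n prime_gt1. Qed.
Let pQ_neq0 k : p%:R ^+ k != 0 :> Qp.
Proof. by rewrite expf_neq0 // (padic_prime_neq0 R). Qed.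

Lemma natr_exp_ge (e : R) : exists k, e <= p%:R ^+ k.
Proof.
have [e0|e0] := leP e 0; first by exists 0%N; rewrite expr0 (le_trans e0).
have ei : 0 < e^-1 by rewrite invr_gt0.
have [k kP] := natr_expN_lt (prime_gt1 p_pr) ei.
by exists k; rewrite -lef_pV2 ?posrE ?exprn_gt0 // ltW.
Qed.

(** Clear the denominator with a power p^m, then keep the residue of x p^m modulo p^m. *)
Lemma padic_fracP (x : Qp) : exists a m : nat,
  (a < p ^ m)%N /\ abs (x - a%:R / p%:R ^+ m) <= 1.
Proof.
have [m xm] := natr_exp_ge (abs x).
have /padic_integerP[y xy] : abs (x * p%:R ^+ m) <= 1.
  by rewrite padic_absM padic_absX padic_abs_prime exprVn ler_pdivrMr ?exprn_gt0 ?mul1r.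
exists (y m), m; split; first exact: residue_lt.
have -> : x - (y m)%:R / p%:R ^+ m = (x * p%:R ^+ m - (y m)%:R) / p%:R ^+ m.
  by rewrite mulrBl mulfK.
rewrite padic_absM padic_abs_primeXN xy.
have -> : ((y m)%:R : Qp) = FracField.tofrac ((y m)%:R : Zp) by rewrite rmorph_nat.
rewrite -rmorphB padic_abs_tofrac -ler_pdivlMr ?exprn_gt0 // mul1r.
by rewrite zp_abs_le -zp_subr_eq zp_natE residue_mod.
Qed.

(** Z[1/p] meets Z_p in Z: the difference is N / p^(m + l), and integrality forces p^(m + l) to
    divide N, so the two real numbers differ by an integer. The first hypothesis makes N a natural
    number. *)
Lemma padic_frac_eq_mod (a m b l : nat) : (b * p ^ m <= a * p ^ l)%N ->
  abs (a%:R / p%:R ^+ m - b%:R / p%:R ^+ l) <= 1 ->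
  cis (a%:R / p%:R ^+ m) = cis (b%:R / p%:R ^+ l).
Proof.
move=> ba; have -> : a%:R / p%:R ^+ m - b%:R / p%:R ^+ l =
    (a * p ^ l - b * p ^ m)%N%:R / p%:R ^+ (m + l) :> Qp.
  by rewrite natrB // !natrM !natrX exprD -mulNr addf_div ?pQ_neq0 // mulNr.
rewrite padic_absM padic_abs_primeXN -ler_pdivlMr ?exprn_gt0 // mul1r.
rewrite padic_abs_nat_le => /dvdnP[c e].
have -> : a%:R / p%:R ^+ m = b%:R / p%:R ^+ l + c%:R :> R.
  have : (a * p ^ l)%:R = (b * p ^ m + c * p ^ (m + l))%:R :> R.
    by rewrite -e subnKC.
  rewrite natrD !natrM !natrX exprD => e'.
  have pk k : p%:R ^+ k != 0 :> R by rewrite expf_neq0 // gt_eqF.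
  apply: (mulIf (pk m)); apply: (mulIf (pk l)).
  rewrite divfK // e'; field; exact: pk.
by rewrite cisD cis_nat mulr1.
Qed.

(** Frees the character from the chosen representative: any fraction a / p^m congruent to [x] modulo
    Z_p computes it, even with a >= p^m. This is what makes additivity accessible. *)
Lemma padic_charE (x : Qp) (a m : nat) : abs (x - a%:R / p%:R ^+ m) <= 1 ->
  chi x = cis (a%:R / p%:R ^+ m).
Proof.
move=> xa; rewrite /padic_char -/(cis _).
(* Existence guarantees that [xget] returns a genuine fractional part and not its default 0. *)
have : exists q : R, exists a m : nat, [/\ (a < p ^ m)%N,
    q = a%:R / p%:R ^+ m & padic_integer (x - a%:R / p%:R ^+ m)].
  have [b [l [bl xb]]] := padic_fracP x.
  by exists (b%:R / p%:R ^+ l), b, l; split => //; apply/(padic_integerP R).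
move=> /xgetPex => /(_ 0); rewrite -/(padic_frac R x).
move=> [b [l [bl -> /(padic_integerP R) xb]]].
have [ba|/ltnW ab] := leqP (b * p ^ m) (a * p ^ l).
  apply/esym/padic_frac_eq_mod => //.
  by rewrite -(subrKA x) -opprB addrC; apply: padic_absB_le.
apply: padic_frac_eq_mod => //.
by rewrite -(subrKA x) -opprB addrC; apply: padic_absB_le.
Qed.

Lemma padic_charD x y : chi (x + y) = chi x * chi y.
Proof.
have [a [m [_ xa]]] := padic_fracP x; have [b [l [_ yb]]] := padic_fracP y.
rewrite (padic_charE xa) (padic_charE yb) -cisD.
have pk k : p%:R ^+ k != 0 :> R by rewrite expf_neq0 // gt_eqF.
have -> : a%:R / p%:R ^+ m + b%:R / p%:R ^+ l =
    (a * p ^ l + b * p ^ m)%N%:R / p%:R ^+ (m + l) :> R.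
  by rewrite natrD !natrM !natrX exprD addf_div ?pk.
apply: padic_charE.
have -> : (a * p ^ l + b * p ^ m)%N%:R / p%:R ^+ (m + l) =
   a%:R / p%:R ^+ m + b%:R / p%:R ^+ l :> Qp.
  by rewrite natrD !natrM !natrX exprD addf_div ?pQ_neq0.
by rewrite opprD addrACA; apply: padic_abs_add_le.
Qed.

Lemma padic_char1 x : abs x <= 1 -> chi x = 1.
Proof.
move=> x1; rewrite (@padic_charE x 0 0) ?mul0r ?subr0 //.
exact: (cis_nat 0).
Qed.

Lemma padic_char_conj x : chi (- x) = (chi x)^*%C.
Proof.
have e : chi (- x) * chi x = 1.
  by rewrite -padic_charD addNr padic_char1 // padic_abs0.
have e' : (chi x)^*%C * chi x = 1 by exact: cis_conj.
have x0 : chi x != 0.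
  by apply: contraTneq isT => x0; move: e; rewrite x0 mulr0 => /eqP; rewrite eq_sym oner_eq0.
by apply: (mulIf x0); rewrite e e'.
Qed.

(** The nontriviality from which the vanishing of all character integrals is drawn. *)
Lemma padic_char_inv_prime : chi p%:R^-1 <> 1.
Proof.
rewrite (@padic_charE _ 1 1) ?expr1 ?mul1r ?subrr ?padic_abs0 //.
exact/cis_inv_neq1/prime_gt1.
Qed.

End Character.

(** * Locally constant functions, measurability and decomposition into cosets *)

Section LocallyConstant.
Local Open Scope classical_set_scope.
Variables (R : realType) (p : nat) (p_pr : prime p) (n : nat).
Notation Zp := (padic_int p_pr).
Notation Qp := (padic p_pr).
Notation Qpn := 'rV[padic p_pr]_n.
Notation borel := (g_sigma_algebraType (@open Qpn)).
Notation abs := (@padic_abs p p_pr R).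
Notation norm := (@padic_norm R p p_pr n).
Notation chi := (@padic_char R p p_pr).
Notation ball c := (@padic_ball R p p_pr n c).

Let pR_gt0 : 0 < p%:R :> R. Proof. by rewrite ltr0n prime_gt0. Qed.
Let pR_gt1 : 1 < p%:R :> R. Proof. by rewrite ltr1n prime_gt1. Qed.
Let pRX_gt0 k : 0 < p%:R ^+ k :> R. Proof. by rewrite exprn_gt0. Qed.
Let pRN_gt0 k : 0 < p%:R ^- k :> R. Proof. by rewrite invr_gt0. Qed.

Lemma near_padic_shift (x : Qpn) (c : R) : 0 < c ->
  \forall y \near x, norm (y - x) <= c.
Proof.
move=> c0; apply/(nbhs_padic_row R).
have [k /ltW kc] := natr_expN_lt (prime_gt1 p_pr) c0.
by exists k => y /le_trans; apply.
Qed.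

Lemma near_padic_norm_le (x : Qpn) (c : R) : 0 < c ->
  \forall y \near x, (norm y <= c) = (norm x <= c).
Proof.
move=> c0; apply: filterS (near_padic_shift x c0) => y yx.
by rewrite -{1}(subrK x y) addrC padic_norm_shift.
Qed.

Lemma near_padic_norm (x : Qpn) : x != 0 ->
  \forall y \near x, norm y = norm x.
Proof.
move=> /(padic_norm_gt0 R) x0.
apply: filterS (near_padic_shift x (divr_gt0 x0 (ltr0Sn R 1))) => y yx.
rewrite -{1}(subrK x y) addrC padic_normD_eq // (le_lt_trans yx) //.
by rewrite ltr_pdivrMr // ltr_pMr // ltr1n.
Qed.

Lemma near_padic_coord (x : Qpn) i : x ord0 i != 0 ->
  \forall y \near x, abs ((y : Qpn) ord0 i) = abs (x ord0 i).
Proof.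
move=> xi0; have x0 : 0 < abs (x ord0 i).
  rewrite lt_neqAle padic_abs_ge0 andbT eq_sym.
  by apply: contra_neq xi0 => /padic_abs_eq0.
apply: filterS (near_padic_shift x (divr_gt0 x0 (ltr0Sn R 1))) => y yx.
rewrite -{1}(subrK (x ord0 i) (y ord0 i)) addrC padic_absD_eq //.
have := padic_abs_le_norm R (y - x) i; rewrite !mxE => /le_lt_trans; apply.
rewrite (le_lt_trans yx) //.
by rewrite ltr_pdivrMr // ltr_pMr // ltr1n.
Qed.

Lemma closed_near (A : set Qpn) :
  (forall x, ~ A x -> \forall y \near x, ~ A y) -> closed A.
Proof. by move=> H; rewrite -openC openE => x /H. Qed.

Lemma closed_padic_ball c : 0 < c -> closed (ball c).
Proof.
move=> c0; apply: closed_near => x xc.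
by apply: filterS (near_padic_norm_le x c0) => y; rewrite /padic_ball /= => ->.
Qed.

Lemma open_padic_ball c : 0 < c -> open (ball c).
Proof.
move=> c0; rewrite openE => x /= xc; rewrite /interior.
by apply: filterS (near_padic_norm_le x c0) => y; rewrite /padic_ball /= => ->.
Qed.

Lemma closed_padic0 : closed [set (0 : Qpn)].
Proof.
apply: closed_near => x /eqP x0; apply: filterS (near_padic_norm x0) => y yx /= y0.
by move: yx; rewrite y0 padic_norm0 => /esym/padic_norm_eq0/eqP; rewrite (negPf x0).
Qed.

Lemma open_measurable_borel (A : set borel) : open (A : set Qpn) -> measurable A.
Proof. by move=> oA; apply: sub_sigma_algebra. Qed.

Lemma closed_measurable_borel (A : set borel) : closed (A : set Qpn) -> measurable A.
Proof.
move=> cA; rewrite -[A]setCK; apply: measurableC; apply: open_measurable_borel.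
by rewrite openC.
Qed.

Lemma measurable_padic_ball c : 0 < c -> measurable (ball c : set borel).
Proof. by move=> c0; apply: open_measurable_borel; exact: open_padic_ball. Qed.

(** A preimage is an open set, to which the closed set [D] is added when it contains [c]. Applied
    with [D] the origin, a coordinate hyperplane, or the empty set. *)
Lemma measurable_locally_constant_off d (T : measurableType d)
    (D : set Qpn) (h : Qpn -> T) (c : T) : closed D ->
  (forall x, D x -> h x = c) ->
  (forall x, ~ D x -> \forall y \near x, h y = h x) ->
  measurable_fun [set: borel] (h : borel -> T).
Proof.
move=> cD hD hND _ Y mY; rewrite setTI.
have mO : measurable (~` D `&` h @^-1` Y : set borel).
  apply: open_measurable_borel; rewrite openE => x [xD hx].
  have oD : open (~` D) by rewrite openC.
  have nD : \forall y \near x, (~` D) y by exact: open_nbhs_nbhs.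
  by apply: filterS2 nD (hND _ xD) => y yD hy; split=> //=; rewrite hy.
have [cY|cY] := pselect (Y c).
  have -> : h @^-1` Y = D `|` (~` D `&` h @^-1` Y).
    apply/seteqP; split=> [x /= hx|x /= [/hD ->//|[]//]].
    by have [?|?] := pselect (D x); [left|right].
  by apply: measurableU => //; exact: closed_measurable_borel.
have -> : h @^-1` Y = ~` D `&` h @^-1` Y; last by [].
apply/seteqP; split=> [x /= hx|x /= []//]; split=> // /hD hc.
by apply: cY; rewrite -hc.
Qed.

Lemma measurable_locally_constant d (T : measurableType d) (h : Qpn -> T) :
  (forall x, \forall y \near x, h y = h x) ->
  measurable_fun [set: borel] (h : borel -> T).
Proof.
by move=> hP; apply: (@measurable_locally_constant_off _ _ set0 h (h 0) closed0).
Qed.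

Lemma measurable_padic_shift (a : Qpn) :
  measurable_fun [set: borel] (fun x : borel => (a + x)%R : borel).
Proof.
apply: (measurability (@open Qpn : set (set borel))) => //.
move=> _ [A oA <-]; rewrite setTI; apply: open_measurable_borel.
rewrite openE => x /= Ax; move: oA; rewrite openE => /(_ _ Ax)/nbhs_padic_row-/(_ R)[k kA].
apply/(nbhs_padic_row R); exists k => y yx; apply: kA.
by rewrite opprD addrACA subrr add0r.
Qed.

Lemma padic_dot_abs_le (x y : Qpn) (a b : R) : 0 <= a -> norm x <= a -> norm y <= b ->
  abs (padic_dot x y) <= a * b.
Proof.
move=> a0 xa yb; have b0 := le_trans (padic_norm_ge0 R y) yb.
rewrite /padic_dot; apply: (big_ind (fun z => abs z <= a * b)).
- by rewrite padic_abs0 mulr_ge0.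
- by move=> u v; exact: padic_abs_add_le.
move=> i _; rewrite padic_absM ler_pM ?padic_abs_ge0 //.
- exact: le_trans (padic_abs_le_norm _ _ _) xa.
- exact: le_trans (padic_abs_le_norm _ _ _) yb.
Qed.

Lemma padic_dotDl (x y z : Qpn) : padic_dot (x + y) z = padic_dot x z + padic_dot y z.
Proof. by rewrite /padic_dot -big_split; apply: eq_bigr => i _; rewrite mxE mulrDl. Qed.

Lemma padic_dotC (x y : Qpn) : padic_dot x y = padic_dot y x.
Proof. by apply: eq_bigr => i _; rewrite mulrC. Qed.

Lemma padic_dotDr (x y z : Qpn) : padic_dot x (y + z) = padic_dot x y + padic_dot x z.
Proof. by rewrite padic_dotC padic_dotDl !(padic_dotC x). Qed.

Lemma padic_dotNr (x y : Qpn) : padic_dot x (- y) = - padic_dot x y.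
Proof. by rewrite /padic_dot -sumrN; apply: eq_bigr => i _; rewrite mxE mulrN. Qed.

Lemma near_padic_char (x xi : Qpn) :
  \forall y \near x, chi (padic_dot y xi) = chi (padic_dot x xi).
Proof.
have c0 : 0 < (norm xi + 1)^-1 by rewrite invr_gt0 ltr_wpDl ?padic_norm_ge0.
apply: filterS (near_padic_shift x c0) => y yx.
rewrite -{1}(subrK x y) padic_dotDl padic_charD padic_char1 ?mul1r //.
have xi1 : norm xi <= norm xi + 1 by rewrite lerDl.
apply: le_trans (padic_dot_abs_le (ltW c0) yx xi1) _.
by rewrite mulVf // gt_eqF // -invr_gt0.
Qed.

(** Invariance radius p^-m and support radius p^m are tied to one parameter: the two balls are dual
    to each other, so the Fourier transform exchanges the two conditions. *)
Definition step (m : nat) (h : Qpn -> R) : Prop :=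
  (forall x y, norm y <= p%:R ^- m -> h (x + y) = h x) /\
  (forall x, p%:R ^+ m < norm x -> h x = 0).

Lemma step_locally_constant m h : step m h -> forall x, \forall y \near x, h y = h x.
Proof.
move=> [hm _] x; apply: filterS (near_padic_shift x (pRN_gt0 m)) => y yx.
by rewrite -{1}(subrK x y) addrC hm.
Qed.

Lemma step_mono m m' h : (m <= m')%N -> step m h -> step m' h.
Proof.
move=> mm [h1 h2]; split=> [x y ym|x xm].
  by apply: h1; rewrite (le_trans ym) // lef_pV2 ?posrE // ler_eXn2l.
by apply: h2; apply: le_lt_trans xm; rewrite ler_eXn2l.
Qed.

(** Compactness of the ball makes the radius of local constancy uniform. *)
Lemma locally_constant_step (k : nat) (h : Qpn -> R) :
  (forall x, \forall y \near x, h y = h x) ->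
  (forall x, p%:R ^+ k < norm x -> h x = 0) ->
  exists m, step m h.
Proof.
move=> hl hk.
have := (compact_near_coveringP _).1 (@compact_padic_ball R p p_pr n k) nat \oo
  (fun m x => forall y, norm y <= p%:R ^- m -> h (x + y) = h x) _.
case.
  move=> x xk; have /nbhs_padic_row-/(_ R)[j jh] := hl x.
  near=> y m => z /= zm.
  have yx : norm (y - x) <= p%:R ^- j.
    near: y; exact: near_padic_shift.
  have zj : norm z <= p%:R ^- j.
    rewrite (le_trans zm) // lef_pV2 ?posrE // ler_eXn2l //.
    by near: m; exists j.
  by rewrite !jh // addrAC padic_normD_le.
move=> m _ mP; exists (maxn m k); split=> [x y|x xm]; last first.
  by apply: hk; apply: le_lt_trans xm; rewrite ler_eXn2l // leq_maxr.
move=> ym; have {}ym : norm y <= p%:R ^- m.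
  by rewrite (le_trans ym) // lef_pV2 ?posrE // ler_eXn2l // leq_maxl.
have [xk|xk] := leP (norm x) (p%:R ^+ k).
  by apply: (mP m) => //=.
(* Outside the ball the shift is harmless: ||y|| <= p^-m <= 1 <= p^k < ||x||, so x + y stays outside
   as well. *)
rewrite !hk // padic_normD_eq // (le_lt_trans ym) // (le_lt_trans _ xk) //.
by rewrite (@le_trans _ _ 1) // ?invf_le1 // exprn_ege1 // ltW.
Unshelve. all: by end_near. Qed.

(** Representatives of the ball of radius p^k modulo the ball of radius p^(k - K), given by K digits
    in each coordinate. *)
Definition coset_rep (k K : nat) (a : {ffun 'I_n -> 'I_(p ^ K)}) : Qpn :=
  \row_i ((a i)%:R / p%:R ^+ k).

Lemma coset_rep_norm k K a : norm (@coset_rep k K a) <= p%:R ^+ k.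
Proof.
apply/padic_norm_leP => [|i]; first exact: ltW.
rewrite mxE padic_absM padic_abs_primeXN ger_pMl //.
by apply/padic_integerP; exists (a i)%:R; rewrite rmorph_nat.
Qed.

(** The digits are the residues of x_i p^k modulo p^K. They are unique because two numbers below p^K
    congruent modulo p^K are equal. *)
Lemma coset_repP k K (x : Qpn) : norm x <= p%:R ^+ k ->
  exists a, forall b, (norm (x - @coset_rep k K b) <= p%:R ^+ k / p%:R ^+ K) = (b == a).
Proof.
move=> xk; have sol i : exists a : 'I_(p ^ K),
    abs (x ord0 i - a%:R / p%:R ^+ k) <= p%:R ^+ k / p%:R ^+ K.
  have /padic_integerP[z xz] : abs (x ord0 i * p%:R ^+ k) <= 1.
    rewrite padic_absM padic_absX padic_abs_prime exprVn ler_pdivrMr // mul1r.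
    exact: le_trans (padic_abs_le_norm _ _ _) xk.
  exists (Ordinal (residue_lt z K)) => /=.
  have -> : x ord0 i - (z K)%:R / p%:R ^+ k = (x ord0 i * p%:R ^+ k - (z K)%:R) / p%:R ^+ k.
    by rewrite mulrBl mulfK // expf_neq0 // (padic_prime_neq0 R).
  rewrite padic_absM padic_abs_primeXN xz mulrC ler_pM2l //.
  have -> : ((z K)%:R : Qp) = FracField.tofrac ((z K)%:R : Zp) by rewrite rmorph_nat.
  by rewrite -rmorphB padic_abs_tofrac zp_abs_le -zp_subr_eq zp_natE residue_mod.
have [a aP] := choice sol; exists (finfun a) => b; apply/idP/eqP; last first.
  move=> ->; apply/padic_norm_leP => [|i]; first by rewrite divr_ge0 ?ltW.
  by rewrite !mxE ffunE.
move=> xb; apply/ffunP => i; rewrite ffunE; apply: val_inj => /=.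
have := le_trans (padic_abs_le_norm R _ i) xb; rewrite !mxE => h1.
have := padic_absB_le (aP i) h1; rewrite opprB addrC addrA subrK.
rewrite -mulrBl padic_absM padic_abs_primeXN mulrC ler_pM2l //.
have -> : ((b i)%:R - (a i)%:R : Qp) =
    FracField.tofrac ((b i)%:R - (a i)%:R : Zp) by rewrite rmorphB !rmorph_nat.
rewrite padic_abs_tofrac zp_abs_le -zp_subr_eq !zp_natE !modn_small //.
by move=> /eqP.
Qed.

Definition ball_ind (c : R) (x : Qpn) : R := if norm x <= c then 1 else 0.

(** Inside the large ball exactly one coset contains [x]. Outside it none does: the representatives
    lie in the ball, so subtracting one leaves ||x|| unchanged. *)
Lemma coset_rep_sum k K (x : Qpn) (F : {ffun 'I_n -> 'I_(p ^ K)} -> R) c :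
  (forall b, norm (x - @coset_rep k K b) <= p%:R ^+ k / p%:R ^+ K -> F b = c) ->
  \sum_b F b * ball_ind (p%:R ^+ k / p%:R ^+ K) (x - @coset_rep k K b) =
  c * ball_ind (p%:R ^+ k) x.
Proof.
rewrite /ball_ind => Fc; have [xk|xk] := leP (norm x) (p%:R ^+ k).
  have [a aP] := @coset_repP k K x xk; rewrite (bigD1 a) //= big1 ?addr0.
    by rewrite aP eqxx Fc ?aP.
  by move=> b /negPf ba; rewrite aP ba mulr0.
rewrite mulr0 big1 // => b _; rewrite lt_geF ?mulr0 //.
rewrite padic_normD_eq; last by rewrite padic_normN (le_lt_trans (coset_rep_norm _ b)).
by apply: le_lt_trans xk; rewrite ler_pdivrMr // ler_peMr // ?exprn_ege1 // ltW.
Qed.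

(** Explains the choice K = m + m below: the cosets then have radius p^-m inside the ball of radius
    p^m. *)
Lemma expfN_split m : p%:R ^- m = p%:R ^+ m / p%:R ^+ (m + m) :> R.
Proof. by rewrite exprD invfM mulrA mulfV ?mul1r // gt_eqF. Qed.

Lemma step_sumE m h x : step m h ->
  h x = \sum_a h (@coset_rep m (m + m) a) *
                 ball_ind (p%:R ^- m) (x - @coset_rep m (m + m) a).
Proof.
move=> [hm hk]; rewrite expfN_split (@coset_rep_sum _ _ x _ (h x)).
  by rewrite /ball_ind; case: leP => [|/hk ->]; rewrite ?mulr1 ?mul0r.
by move=> b; rewrite -expfN_split => xb; rewrite -(hm _ _ xb) addrC subrK.
Qed.

Lemma schwartz_bruhat_ball (k : nat) (phi : Qpn -> R[i]) :
  (forall x, \forall y \near x, phi y = phi x) ->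
  (forall x, p%:R ^+ k < norm x -> phi x = 0) -> schwartz_bruhat phi.
Proof.
move=> phil phik; split=> //.
apply: (subclosed_compact (@closed_closure _ _) (@compact_padic_ball R p p_pr n k)).
rewrite [X in _ `<=` X]((closure_id _).1 (closed_padic_ball (pRX_gt0 k))).
apply: closureS => x /=; rewrite /padic_ball /= leNgt; apply: contra_neqN.
exact: phik.
Qed.

End LocallyConstant.

(** * Volumes of balls and complex integrals for the Haar measure *)

Section HaarIntegral.
Local Open Scope classical_set_scope.
Variables (R : realType) (p : nat) (p_pr : prime p) (n : nat).
Notation Qp := (padic p_pr).
Notation Qpn := 'rV[padic p_pr]_n.
Notation borel := (g_sigma_algebraType (@open Qpn)).
Notation abs := (@padic_abs p p_pr R).
Notation norm := (@padic_norm R p p_pr n).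
Notation chi := (@padic_char R p p_pr).
Notation ball c := (@padic_ball R p p_pr n c).
Notation C := R[i].
Variable mu : {measure set borel -> \bar R}.
Hypothesis mu_haar : normalized_haar mu.

Let pR_gt0 : 0 < p%:R :> R. Proof. by rewrite ltr0n prime_gt0. Qed.
Let pR_gt1 : 1 < p%:R :> R. Proof. by rewrite ltr1n prime_gt1. Qed.
Let pRX_gt0 k : 0 < p%:R ^+ k :> R. Proof. by rewrite exprn_gt0. Qed.
Let pRN_gt0 k : 0 < p%:R ^- k :> R. Proof. by rewrite invr_gt0. Qed.

Lemma haar_shift (a : Qpn) (A : set borel) : measurable A ->
  mu ((fun x : borel => (a + x)%R : borel) @^-1` A) = mu A.
Proof.
move=> mA; rewrite -(mu_haar.1 (- a) _ mA); congr (mu _).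
apply/seteqP; split=> [x /= Ax|_ [x /= Ax <-]] /=; last by rewrite addNKr.
by exists (a + x) => //; rewrite addKr.
Qed.

Lemma ball_indE c : (fun x : Qpn => ball_ind c x) = \1_(ball c) :> (Qpn -> R).
Proof.
apply/funext => x; rewrite indicE /ball_ind /padic_ball.
by case: ifPn => xc; [rewrite mem_set|rewrite memNset //; apply/negP].
Qed.

Lemma integral_ball_ind c (a : Qpn) : 0 < c ->
  (\int[mu]_x (ball_ind c (x - a))%:E = mu (ball c))%E.
Proof.
move=> c0; have mB := @measurable_padic_ball R p p_pr n c c0.
rewrite -(haar_shift (- a) mB).
rewrite -(setIT (_ @^-1` _)) -integral_indic //; last first.
  by rewrite -[_ @^-1` _]setTI; apply: measurable_padic_shift.
by apply: eq_integral => x _; rewrite addrC (congr1 (fun g => g _) (ball_indE c)).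
Qed.

Lemma near_ball_ind c (a x : Qpn) : 0 < c ->
  \forall y \near x, ball_ind c (y - a) = ball_ind c (x - a) :> R.
Proof.
move=> c0; apply: filterS (near_padic_shift x c0) => y yx.
have -> : y - a = (x - a) + (y - x) by rewrite [RHS]addrC subrKA.
by rewrite /ball_ind padic_norm_shift.
Qed.

Lemma measurable_ball_ind c (a : Qpn) : 0 < c ->
  measurable_fun [set: borel] (fun x : borel => ball_ind c (x - a : Qpn) : R).
Proof.
by move=> c0; apply: measurable_locally_constant => x; exact: near_ball_ind.
Qed.

(** Integrate the partition of the large ball into (p^K)^n translates of the small one; by
    invariance all have the same volume. *)
Lemma haar_ball_cosets k K :
  (mu (ball (p%:R ^+ k)) = ((p ^ K) ^ n)%:R%:E * mu (ball (p%:R ^+ k / p%:R ^+ K)))%E.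
Proof.
have c0 : 0 < p%:R ^+ k / p%:R ^+ K :> R by rewrite divr_gt0.
rewrite -(integral_ball_ind 0 (pRX_gt0 k)).
transitivity (\int[mu]_x \sum_(b : {ffun 'I_n -> 'I_(p ^ K)})
   (ball_ind (p%:R ^+ k / p%:R ^+ K) (x - coset_rep p_pr k b) : R)%:E)%E.
  apply: eq_integral => x _; rewrite subr0 sumEFin; congr (_%:E).
  rewrite -[LHS]mul1r -(@coset_rep_sum R p p_pr n k K x (fun=> 1)) //.
  by apply: eq_bigr => b _; rewrite mul1r.
rewrite ge0_integral_sum //; last 2 first.
- by move=> b; apply/measurable_EFinP; exact: measurable_ball_ind.
- by move=> b x _; rewrite lee_fin /ball_ind; case: ifP.
rewrite (eq_bigr (fun=> mu (ball (p%:R ^+ k / p%:R ^+ K)))); last first.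
  by move=> b _; rewrite integral_ball_ind.
rewrite (_ : ((p ^ K) ^ n)%:R%:E = (\sum_(b : {ffun 'I_n -> 'I_(p ^ K)}) 1%:E)%E).
  by rewrite ge0_sume_distrl //; apply: eq_bigr => b _; rewrite mul1e.
by rewrite sumEFin sumr_const card_ffun !card_ord.
Qed.

Lemma haar_ball1 : mu (ball 1) = 1%E.
Proof.
rewrite -mu_haar.2; congr (mu _); apply/seteqP.
split=> x /=; rewrite /padic_ball /=.
  by move=> /padic_norm_leP x1 i; apply/padic_integerP; exact: x1.
by move=> xi; apply/padic_norm_leP => // i; apply/padic_integerP; exact: xi.
Qed.

Let q m : R := ((p ^ m) ^ n)%N%:R.
Let q_gt0 m : 0 < q m. Proof. by rewrite ltr0n !expn_gt0 prime_gt0. Qed.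

Lemma haar_small_ball m : mu (ball (p%:R ^- m)) = (q m)^-1%:E.
Proof.
have := haar_ball_cosets 0 m; rewrite expr0 haar_ball1 mul1r -/(q m) => e.
have <- : ((q m)^-1%:E * ((q m)%:E * mu (ball (p%:R ^- m))) = mu (ball (p%:R ^- m)))%E.
  by rewrite muleA -EFinM mulVf ?mul1e // lt0r_neq0 // q_gt0.
by rewrite -e mule1.
Qed.

Lemma haar_large_ball m : mu (ball (p%:R ^+ m)) = (q m)%:E.
Proof.
rewrite (haar_ball_cosets m (m + m)) -(expfN_split _ p_pr) haar_small_ball -EFinM.
congr (_%:E); rewrite /q expnD expnMn natrM mulfK //.
by rewrite lt0r_neq0 // q_gt0.
Qed.

Definition haar_vol (c : R) : R := fine (mu (ball c)).

(** The volumes of dual balls are inverse to each other: this is why Fourier inversion and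
    Plancherel hold with constant 1. *)
Lemma haar_volM m : haar_vol (p%:R ^- m) * haar_vol (p%:R ^+ m) = 1.
Proof.
rewrite /haar_vol haar_small_ball haar_large_ball /= mulVf //.
by rewrite lt0r_neq0 // q_gt0.
Qed.

Lemma haar_vol_large m : haar_vol (p%:R ^+ m) = p%:R ^+ (m * n).
Proof. by rewrite /haar_vol haar_large_ball /= /q !natrX exprM. Qed.

Lemma haar_ball_finite c m : c <= p%:R ^+ m -> 0 < c -> (mu (ball c) < +oo)%E.
Proof.
move=> cm c0; apply: (@le_lt_trans _ _ (mu (ball (p%:R ^+ m)))).
  apply: le_measure; rewrite ?inE; [exact: measurable_padic_ball..|].
  by move=> x /= /le_trans; apply.
by rewrite haar_large_ball ltry.
Qed.

Lemma haar_ballE c m : c <= p%:R ^+ m -> 0 < c -> mu (ball c) = (haar_vol c)%:E.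
Proof.
by move=> cm c0; rewrite fineK // ge0_fin_numE // (haar_ball_finite cm c0).
Qed.

Lemma integrable_ball_supported (h : Qpn -> R) (a : Qpn) c m M :
  c <= p%:R ^+ m -> 0 < c ->
  measurable_fun [set: borel] (h : borel -> R) ->
  (forall x, `|h x| <= M * ball_ind c (x - a)) ->
  mu.-integrable [set: borel] (EFin \o (h : borel -> R)).
Proof.
move=> cm c0 mh hM.
have ib : mu.-integrable [set: borel]
    (fun x : borel => (ball_ind c (x - a : Qpn) : R)%:E).
  apply/integrableP; split; first by apply/measurable_EFinP; exact: measurable_ball_ind.
  rewrite (eq_integral (fun x : borel => (ball_ind c (x - a : Qpn) : R)%:E)).
    by rewrite integral_ball_ind // (haar_ball_finite cm c0).
  by move=> x _; rewrite gee0_abs // lee_fin /ball_ind; case: ifP.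
apply: (le_integrable _ _ _ (integrableZl measurableT M ib)) => //.
  exact/measurable_EFinP.
move=> x _ /=; rewrite lee_fin (le_trans (hM x)) //; exact: ler_norm.
Qed.

Definition cintegrable (u : Qpn -> C) : Prop :=
  mu.-integrable [set: borel] (EFin \o (fun x : borel => complex.Re (u x))) /\
  mu.-integrable [set: borel] (EFin \o (fun x : borel => complex.Im (u x))).

Notation cint := (@cintegral R p p_pr n mu).

Lemma eq_cintegral u v : u =1 v -> cint u = cint v.
Proof. by move=> /funext ->. Qed.

Lemma cintegralD u v : cintegrable u -> cintegrable v ->
  cintegrable (fun x => u x + v x) /\ cint (fun x => u x + v x) = cint u + cint v.
Proof.
move=> [ur ui] [vr vi].
have reE : (fun x : borel => complex.Re (u x + v x)) =
   (fun x => complex.Re (u x) + complex.Re (v x)).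
  by apply/funext => x; case: (u x) (v x) => [? ?] [? ?].
have imE : (fun x : borel => complex.Im (u x + v x)) =
   (fun x => complex.Im (u x) + complex.Im (v x)).
  by apply/funext => x; case: (u x) (v x) => [? ?] [? ?].
rewrite /cintegrable /cintegral reE imE !RintegralD //; split=> //.
by split; [exact: (integrableD measurableT ur vr)|exact: (integrableD measurableT ui vi)].
Qed.

Lemma cintegralZ (a : C) u : cintegrable u ->
  cintegrable (fun x => a * u x) /\ cint (fun x => a * u x) = a * cint u.
Proof.
case: a => a b [ur ui].
have reE : (fun x : borel => complex.Re (Complex a b * u x)) =
   (fun x => a * complex.Re (u x) - b * complex.Im (u x)).
  by apply/funext => x; case: (u x) => [? ?].
have imE : (fun x : borel => complex.Im (Complex a b * u x)) =
   (fun x => a * complex.Im (u x) + b * complex.Re (u x)).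
  by apply/funext => x; case: (u x) => [? ?].
have iZ r (h : borel -> R) : mu.-integrable [set: borel] (EFin \o h) ->
    mu.-integrable [set: borel] (EFin \o (fun x => r * h x)).
  exact: integrableZl.
rewrite /cintegrable /cintegral reE imE; split.
  split; first exact: (integrableB measurableT (iZ a _ ur) (iZ b _ ui)).
  exact: (integrableD measurableT (iZ a _ ui) (iZ b _ ur)).
rewrite RintegralB ?RintegralD ?RintegralZl //; exact: iZ.
Qed.

Lemma cintegral_sum (I : finType) (u : I -> Qpn -> C) :
  (forall i, cintegrable (u i)) ->
  cintegrable (fun x => \sum_i u i x) /\ cint (fun x => \sum_i u i x) = \sum_i cint (u i).
Proof.
move=> ui; have H (s : seq I) : cintegrable (fun x => \sum_(i <- s) u i x) /\
    cint (fun x => \sum_(i <- s) u i x) = \sum_(i <- s) cint (u i).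
  elim: s => [|i s [IH1 IH2]].
    rewrite big_nil (_ : (fun _ => _) = (fun=> 0)); last by apply/funext => x; rewrite big_nil.
    split; first by split; exact: integrable0.
    by rewrite /cintegral /= !Rintegral_cst // mul0r.
  rewrite big_cons (_ : (fun _ => _) = (fun x => u i x + \sum_(j <- s) u j x)).
    by have [? ->] := cintegralD (ui i) IH1; rewrite IH2.
  by apply/funext => x; rewrite big_cons.
exact: H (index_enum I).
Qed.

Lemma cintegrable_loc c m M (a : Qpn) (u : Qpn -> C) :
  c <= p%:R ^+ m -> 0 < c ->
  (forall x, \forall y \near x, u y = u x) ->
  (forall x, Normc.normc (u x) <= M * ball_ind c (x - a)) -> cintegrable u.
Proof.
move=> cm c0 ul uM; split; apply: (integrable_ball_supported (a := a) (M := M) cm c0).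
- by apply: measurable_locally_constant => x; apply: filterS (ul x) => y ->.
- move=> x; apply: le_trans (uM x); case: (u x) => r s /=.
  by rewrite -sqrtr_sqr ler_wsqrtr // lerDl sqr_ge0.
- by apply: measurable_locally_constant => x; apply: filterS (ul x) => y ->.
- move=> x; apply: le_trans (uM x); case: (u x) => r s /=.
  by rewrite -sqrtr_sqr ler_wsqrtr // lerDr sqr_ge0.
Qed.

(** Translation invariance says that the pushforward of [mu] along the shift is [mu]; the rest is
    change of variables. *)
Lemma Rintegral_shift (a : Qpn) (h : Qpn -> R) :
  measurable_fun [set: borel] (h : borel -> R) ->
  mu.-integrable [set: borel] (fun x : borel => (h (a + x))%:E) ->
  \int[mu]_x h (a + x) = \int[mu]_x h x.
Proof.
move=> mh ih; rewrite /Rintegral; congr fine.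
have ms := @measurable_padic_shift R p p_pr n a.
have mEh : measurable_fun [set: borel] (EFin \o (h : borel -> R)).
  exact/measurable_EFinP.
have e := integral_pushforward ms mEh (ih : mu.-integrable (_ @^-1` setT) _) measurableT.
apply: etrans (esym e) _; apply: (eq_measure_integral mu) => A mA _.
exact: haar_shift.
Qed.

Lemma cintegral_shift (a : Qpn) (u : Qpn -> C) : cmeasurable u ->
  cintegrable (fun x => u (a + x)) -> cint (fun x => u (a + x)) = cint u.
Proof.
move=> [mr mi] [ir ii]; rewrite /cintegral.
rewrite (@Rintegral_shift a (fun x => complex.Re (u x))) //.
by rewrite (@Rintegral_shift a (fun x => complex.Im (u x))).
Qed.

End HaarIntegral.

(** * Fourier transforms of indicators of balls *)

Section StepFourier.
Local Open Scope classical_set_scope.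
Variables (R : realType) (p : nat) (p_pr : prime p) (n : nat).
Notation Qp := (padic p_pr).
Notation Qpn := 'rV[padic p_pr]_n.
Notation borel := (g_sigma_algebraType (@open Qpn)).
Notation abs := (@padic_abs p p_pr R).
Notation norm := (@padic_norm R p p_pr n).
Notation chi := (@padic_char R p p_pr).
Notation ball c := (@padic_ball R p p_pr n c).
Notation C := R[i].
Variable mu : {measure set borel -> \bar R}.
Hypothesis mu_haar : normalized_haar mu.
Notation cint := (@cintegral R p p_pr n mu).
Notation vol := (@haar_vol R p p_pr n mu).

Let pR_gt0 : 0 < p%:R :> R. Proof. by rewrite ltr0n prime_gt0. Qed.
Let pR_gt1 : 1 < p%:R :> R. Proof. by rewrite ltr1n prime_gt1. Qed.
Let pRX_gt0 k : 0 < p%:R ^+ k :> R. Proof. by rewrite exprn_gt0. Qed.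
Let pRN_gt0 k : 0 < p%:R ^- k :> R. Proof. by rewrite invr_gt0. Qed.

Lemma normc_real (r : R) : Normc.normc r%:C%C = `|r|.
Proof. by rewrite /= expr0n addr0 sqrtr_sqr. Qed.

Lemma normc_sqr (u : C) : (Normc.normc u ^+ 2)%:C%C = u * u^*%C.
Proof.
case: u => a b; rewrite /Normc.normc sqr_sqrtr ?addr_ge0 ?sqr_ge0 //=.
by simpc; congr Complex; ring.
Qed.

Lemma normc_char x : Normc.normc (chi x) = 1.
Proof. by rewrite /padic_char /Normc.normc cos2Dsin2 sqrtr1. Qed.

Lemma ball_ind_ge0 c (x : Qpn) : 0 <= ball_ind c x :> R.
Proof. by rewrite /ball_ind; case: ifP. Qed.

Lemma cintegrable_char c m (x a : Qpn) : c <= p%:R ^+ m -> 0 < c ->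
  cintegrable mu (fun y => chi (padic_dot x y) * (ball_ind c (y - a))%:C%C).
Proof.
move=> cm c0; apply: (cintegrable_loc mu_haar (M := 1) (a := a) cm c0) => y.
  apply: filterS2 (near_padic_char R y x) (near_ball_ind a y c0) => z.
  by rewrite !(padic_dotC x) => -> ->.
by rewrite Normc.normcM normc_char normc_real ger0_norm ?ball_ind_ge0.
Qed.

(** The value group consists of the integral powers of p, so nothing lies strictly between 1 and p.
    The gap leaves room to divide by p inside a ball. *)
Lemma padic_abs_gt1 (y : Qp) : 1 < abs y -> p%:R <= abs y.
Proof.
move=> y1; have y0 : y != 0.
  by apply: contraTneq y1 => ->; rewrite padic_abs0 ltr10.
have [[k|k] yk] := padic_abs_val R y0; rewrite yk; last first.
  by move: y1; rewrite yk NegzE -exprnN ltNge invf_le1 ?exprn_ege1 // ltW.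
case: k yk => [|k] yk; first by move: y1; rewrite yk expr0z ltxx.
by rewrite -exprnP exprS ler_peMr ?exprn_ege1 ?(ltW pR_gt0) // ltW.
Qed.

(* If ||x|| > |z|^-1 then some a in the ball has chi (x . a) <> 1, and
   translating the variable by a multiplies the integral by chi (x . a). *)
Lemma ball_fourier0 (z : Qp) (x : Qpn) : z != 0 ->
  cint (fun y => chi (padic_dot x y) * (ball_ind (abs z) y)%:C%C) =
  (vol (abs z) * ball_ind (abs z)^-1 x)%:C%C.
Proof.
move=> z0; set c := abs z; have c0 : 0 < c.
  rewrite lt_neqAle padic_abs_ge0 eq_sym andbT.
  by apply: contra_neq z0 => /padic_abs_eq0.
have [m cm] := natr_exp_ge p_pr c.
have ic : cintegrable mu (fun y => chi (padic_dot x y) * (ball_ind c y)%:C%C).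
  have := cintegrable_char x 0 cm c0.
  by under eq_fun do rewrite subr0.
have [xc|xc] := leP (norm x) c^-1.
  rewrite {2}/ball_ind xc mulr1.
  rewrite (@eq_cintegral _ _ _ _ _ _ (fun y => (ball_ind c y)%:C%C)); last first.
    move=> y; rewrite {1 2}/ball_ind; case: ifP => yc; last by rewrite mulr0.
    rewrite padic_char1 ?mul1r //.
    have ci0 : 0 <= c^-1 by rewrite invr_ge0 ltW.
    by apply: le_trans (padic_dot_abs_le ci0 xc yc) _; rewrite mulVf // gt_eqF.
  rewrite /cintegral /= Rintegral_cst // mul0r; congr Complex.
  rewrite /Rintegral; congr fine; rewrite -(integral_ball_ind mu_haar 0 c0).
  by apply: eq_integral => y _; rewrite subr0.
rewrite /ball_ind [in RHS]lt_geF // mulr0.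
have [i xi] : exists i, c^-1 < abs (x ord0 i).
  apply/not_existsP => H; move: xc; rewrite ltNge => /negP; apply.
  by apply/padic_norm_leP => [|i]; [rewrite invr_ge0 ltW|rewrite leNgt; apply/negP/H].
have xi0 : 0 < abs (x ord0 i) by rewrite (lt_trans _ xi) // invr_gt0.
(* Chosen so that x . a = 1/p, where the character is not 1. Its norm p / |x_i| is at most |z|
   because |z x_i| > 1 forces |z x_i| >= p. *)
pose a : Qpn := \row_j (if j == i then (p%:R * x ord0 i)^-1 else 0).
have xa : padic_dot x a = p%:R^-1.
  rewrite /padic_dot (bigD1 i) //= big1 ?addr0; last first.
    by move=> j /negPf ji; rewrite mxE ji mulr0.
  rewrite mxE eqxx invfM mulrCA mulfV ?mulr1 //.
  by apply: contraTneq xi0 => ->; rewrite padic_abs0 ltxx.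
have ac : norm a <= c.
  apply/padic_norm_leP => [|j]; first exact: ltW.
  rewrite mxE; case: ifP => _; last by rewrite padic_abs0 ltW.
  rewrite padic_absV padic_absM padic_abs_prime invfM invrK ler_pdivrMr //.
  rewrite -padic_absM; apply: padic_abs_gt1; rewrite padic_absM.
  by rewrite -ltr_pdivrMl // mulr1.
have sE : (fun y => chi (padic_dot x (a + y)) * (ball_ind c (a + y))%:C%C) =
   (fun y => chi p%:R^-1 * (chi (padic_dot x y) * (ball_ind c y)%:C%C)).
  apply/funext => y; rewrite padic_dotDr xa padic_charD mulrA.
  by rewrite /ball_ind addrC padic_norm_shift.
have [ia ea] := cintegralZ (chi p%:R^-1) ic.
have := cintegral_shift (a := a) mu_haar (u := fun y => chi (padic_dot x y) * (ball_ind c y)%:C%C).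
rewrite sE ea => /(_ _ ia) e.
have {}e : chi p%:R^-1 * cint (fun y => chi (padic_dot x y) * (ball_ind c y)%:C%C) =
  cint (fun y => chi (padic_dot x y) * (ball_ind c y)%:C%C).
  apply: e; case: ic => /measurable_int/measurable_EFinP ? /measurable_int/measurable_EFinP ?.
  by split.
move/eqP: e; rewrite -subr_eq0 -[X in _ - X]mul1r -mulrBl mulf_eq0 subr_eq0.
by move=> /orP[/eqP /padic_char_inv_prime //|/eqP].
Qed.

(** Translating to the centre [a] pulls out the factor chi (x . a). With the radius written [abs z],
    small balls (z = p^m) and large ones (z = p^-m) are both instances of one computation. *)
Lemma ball_fourier (z : Qp) (x a : Qpn) : z != 0 ->
  cint (fun y => chi (padic_dot x y) * (ball_ind (abs z) (y - a))%:C%C) =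
  chi (padic_dot x a) * (vol (abs z) * ball_ind (abs z)^-1 x)%:C%C.
Proof.
move=> z0; set c := abs z; have c0 : 0 < c.
  rewrite lt_neqAle padic_abs_ge0 eq_sym andbT.
  by apply: contra_neq z0 => /padic_abs_eq0.
have [m cm] := natr_exp_ge p_pr c.
have ic := cintegrable_char x a cm c0.
have ic0 : cintegrable mu (fun y => chi (padic_dot x y) * (ball_ind c y)%:C%C).
  have := cintegrable_char x 0 cm c0.
  by under eq_fun do rewrite subr0.
have [ia ea] := cintegralZ (chi (padic_dot x a)) ic0.
rewrite -(ball_fourier0 x z0) -ea.
have sE : (fun y => chi (padic_dot x (a + y)) * (ball_ind c (a + y - a))%:C%C) =
   (fun y => chi (padic_dot x a) * (chi (padic_dot x y) * (ball_ind c y)%:C%C)).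
  by apply/funext => y; rewrite padic_dotDr padic_charD mulrA [a + y - a]addrAC subrr add0r.
rewrite -sE in ia *.
rewrite (cintegral_shift (a := a) mu_haar (u := fun y => chi (padic_dot x y) * (ball_ind c (y - a))%:C%C)) //.
by case: ic => /measurable_int/measurable_EFinP ? /measurable_int/measurable_EFinP ?; split.
Qed.

Lemma small_ball_fourier m (x a : Qpn) :
  cint (fun y => chi (padic_dot x y) * (ball_ind (p%:R ^- m) (y - a))%:C%C) =
  chi (padic_dot x a) * (vol (p%:R ^- m) * ball_ind (p%:R ^+ m) x)%:C%C.
Proof.
have z0 : (p%:R ^+ m : Qp) != 0 by rewrite expf_neq0 // (padic_prime_neq0 R).
have := ball_fourier x a z0.
by rewrite padic_absX padic_abs_prime exprVn invrK.
Qed.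

Lemma large_ball_fourier m (x : Qpn) :
  cint (fun y => chi (padic_dot x y) * (ball_ind (p%:R ^+ m) y)%:C%C) =
  (vol (p%:R ^+ m) * ball_ind (p%:R ^- m) x)%:C%C.
Proof.
have z0 : (p%:R ^- m : Qp) != 0.
  by rewrite invr_eq0 expf_neq0 // (padic_prime_neq0 R).
by have := ball_fourier0 x z0; rewrite padic_abs_primeXN.
Qed.

End StepFourier.

(** * Fourier inversion and Plancherel for step functions *)

Section StepInversion.
Local Open Scope classical_set_scope.
Variables (R : realType) (p : nat) (p_pr : prime p) (n : nat).
Notation Qp := (padic p_pr).
Notation Qpn := 'rV[padic p_pr]_n.
Notation borel := (g_sigma_algebraType (@open Qpn)).
Notation norm := (@padic_norm R p p_pr n).
Notation chi := (@padic_char R p p_pr).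
Notation C := R[i].
Variable mu : {measure set borel -> \bar R}.
Hypothesis mu_haar : normalized_haar mu.
Notation cint := (@cintegral R p p_pr n mu).
Notation vol := (@haar_vol R p p_pr n mu).

Let pR_gt0 : 0 < p%:R :> R. Proof. by rewrite ltr0n prime_gt0. Qed.
Let pR_gt1 : 1 < p%:R :> R. Proof. by rewrite ltr1n prime_gt1. Qed.
Let pRX_gt0 k : 0 < p%:R ^+ k :> R. Proof. by rewrite exprn_gt0. Qed.
Let pRN_gt0 k : 0 < p%:R ^- k :> R. Proof. by rewrite invr_gt0. Qed.
Let pRN_le k m : p%:R ^- k <= p%:R ^+ m :> R.
Proof.
by rewrite (@le_trans _ _ 1) ?exprn_ege1 ?invf_le1 ?exprn_ege1 // ltW.
Qed.

Variable m : nat.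
Notation rep := (@coset_rep p p_pr n m (m + m)).
Notation I := {ffun 'I_n -> 'I_(p ^ (m + m))}.

(** Each coset indicator contributes chi (x . a), its volume, and the indicator of the dual ball,
    which is common to all cosets. The result is a character sum cut off to a ball, from which
    linearity, inversion and Plancherel can be read. *)
Lemma step_fourier_inv (h : Qpn -> R) (x : Qpn) : step m h ->
  fourier_inv mu (fun xi => (h xi)%:C%C) x =
  (vol (p%:R ^- m) * ball_ind (p%:R ^+ m) x)%:C%C *
    \sum_(a : I) (h (rep a))%:C%C * chi (padic_dot x (rep a)).
Proof.
move=> hm; rewrite /fourier_inv.
rewrite (@eq_cintegral _ _ _ _ _ _ (fun y => \sum_(a : I) (h (rep a))%:C%C *
   (chi (padic_dot x y) * (ball_ind (p%:R ^- m) (y - rep a))%:C%C))); last first.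
  move=> y; rewrite (step_sumE y hm) rmorph_sum mulr_sumr; apply: eq_bigr => a _.
  by rewrite rmorphM mulrCA.
have ic a := cintegrable_char mu_haar x a (pRN_le m m) (pRN_gt0 m).
rewrite (cintegral_sum (fun a => (cintegralZ _ (ic _)).1)).2 mulr_sumr.
apply: eq_bigr => a _; rewrite (cintegralZ _ (ic _)).2 small_ball_fourier //.
by rewrite mulrA mulrC.
Qed.

(** Integrating chi ((a - xi) . x) over the large ball detects whether [xi] lies in the coset of
    [a], so the sum collapses to the coset expansion of [h]. *)
Lemma step_fourierK (h : Qpn -> R) (xi : Qpn) : step m h ->
  fourier mu (fourier_inv mu (fun xi => (h xi)%:C%C)) xi = (h xi)%:C%C.
Proof.
move=> hm; rewrite /fourier.
rewrite (@eq_cintegral _ _ _ _ _ _ (fun x => \sum_(a : I)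
   ((h (rep a) * vol (p%:R ^- m))%:C%C *
   (chi (padic_dot (rep a - xi) x) * (ball_ind (p%:R ^+ m) x)%:C%C)))); last first.
  move=> x; rewrite step_fourier_inv // mulrA mulr_sumr; apply: eq_bigr => a _.
  rewrite [padic_dot (_ - _) _]padic_dotC padic_dotDr padic_dotNr padic_charD !rmorphM /=.
  ring.
have ic a : cintegrable mu
   (fun x => chi (padic_dot (rep a - xi) x) * (ball_ind (p%:R ^+ m) x)%:C%C).
  have := cintegrable_char mu_haar (rep a - xi) 0 (lexx _) (pRX_gt0 m).
  by under eq_fun do rewrite subr0.
rewrite (cintegral_sum (fun a => (cintegralZ _ (ic _)).1)).2.
rewrite (step_sumE xi hm) rmorph_sum; apply: eq_bigr => a _.
rewrite (cintegralZ _ (ic _)).2 large_ball_fourier // -rmorphM; congr (_%:C%C).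
rewrite mulrA -[h _ * _ * vol _]mulrA haar_volM // mulr1; congr (_ * _).
by rewrite -opprB /ball_ind padic_normN.
Qed.

Lemma step_schwartz (h : Qpn -> R) : step m h ->
  schwartz_bruhat (fourier_inv mu (fun xi => (h xi)%:C%C)).
Proof.
move=> hm; apply: (@schwartz_bruhat_ball R p p_pr n m) => x; last first.
  by move=> xm; rewrite step_fourier_inv // /ball_ind lt_geF // mulr0 mul0r.
have ch : \forall y \near x, forall a : I,
    chi (padic_dot y (rep a)) = chi (padic_dot x (rep a)).
  apply: filterS (near_padic_shift x (pRN_gt0 m)) => y yx a.
  rewrite -{1}(subrK x y) padic_dotDl padic_charD padic_char1 ?mul1r //.
  have ra : norm (rep a) <= p%:R ^+ m by exact: coset_rep_norm.
  have := padic_dot_abs_le (ltW (pRN_gt0 m)) yx ra.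
  by rewrite mulVf // gt_eqF.
apply: filterS2 ch (near_ball_ind 0 x (pRX_gt0 m)) => y cy iy.
rewrite !step_fourier_inv //; move: iy; rewrite !subr0 => ->.
by congr (_ * _); apply: eq_bigr => a _; rewrite cy.
Qed.

Lemma step_sqr (h : Qpn -> R) : step m h -> step m (fun x => h x ^+ 2).
Proof.
by move=> [h1 h2]; split=> [x y /h1 ->//|x /h2 ->]; rewrite expr0n.
Qed.

Lemma step_bounded (h : Qpn -> R) : step m h ->
  exists2 M, 0 <= M & forall x, `|h x| <= M * ball_ind (p%:R ^+ m) x.
Proof.
move=> hm; exists (\sum_(a : I) `|h (rep a)|); first exact: sumr_ge0.
move=> x; rewrite /ball_ind; case: ifPn => xm; last first.
  by rewrite mulr0 hm.2 ?normr0 // ltNge.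
rewrite mulr1 (step_sumE x hm) (le_trans (ler_norm_sum _ _ _)) //.
apply: ler_sum => a _; rewrite normrM ler_piMr //.
by rewrite /ball_ind; case: ifP; rewrite ?normr1 ?normr0.
Qed.

Lemma step_integrable (h : Qpn -> R) : step m h ->
  mu.-integrable [set: borel] (EFin \o (h : borel -> R)).
Proof.
move=> hm; have [M M0 hM] := step_bounded hm.
apply: (integrable_ball_supported mu_haar (a := 0) (M := M) (lexx _) (pRX_gt0 m)).
  by apply: measurable_locally_constant; exact: step_locally_constant hm.
by move=> x; rewrite subr0.
Qed.

(** The inverse transform evaluated at 0. *)
Lemma step_integral (h : Qpn -> R) : step m h ->
  \int[mu]_x h x = vol (p%:R ^- m) * \sum_(a : I) h (rep a).
Proof.
move=> hm; have dot0 y : padic_dot (0 : Qpn) y = 0.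
  by rewrite /padic_dot big1 // => i _; rewrite mxE mul0r.
have chi0 : chi 0 = 1 by rewrite padic_char1 // padic_abs0.
have := step_fourier_inv 0 hm; rewrite /fourier_inv.
rewrite (@eq_cintegral _ _ _ _ _ _ (fun y => (h y)%:C%C)); last first.
  by move=> y; rewrite dot0 chi0 mul1r.
rewrite (eq_bigr (fun a : I => (h (rep a))%:C%C)); last first.
  by move=> a _; rewrite dot0 chi0 mulr1.
rewrite -rmorph_sum -rmorphM /cintegral /= => -[-> _].
by rewrite /ball_ind padic_norm0 ltW ?mulr1.
Qed.

(** The squared modulus is a double sum over cosets; integrating leaves only pairs in the same
    coset, and the volumes combine by [haar_volM]. *)
Lemma step_plancherel (h : Qpn -> R) : step m h ->
  (\int[mu]_x (Normc.normc (fourier_inv mu (fun xi => (h xi)%:C%C) x) ^+ 2)%:E =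
   \int[mu]_x (h x ^+ 2)%:E)%E.
Proof.
move=> hm; have h2 := step_sqr hm; have ih2 := step_integrable h2.
have EFin_int (g : borel -> R) : mu.-integrable [set: borel] (EFin \o g) ->
    (\int[mu]_x (g x)%:E = (\int[mu]_x g x)%:E)%E.
  by move=> ig; rewrite /Rintegral fineK //; exact: integrable_fin_num.
(* The squared modulus is viewed as a complex function so that sums of characters can be integrated
   termwise; its real part is taken at the end. *)
pose u (x : Qpn) : C := (Normc.normc (fourier_inv mu (fun xi => (h xi)%:C%C) x) ^+ 2)%:C%C.
pose k (a b : I) : R := h (rep a) * h (rep b) * vol (p%:R ^- m) ^+ 2.
have uE : u =1 (fun x => \sum_(a : I) \sum_(b : I) (k a b)%:C%C *
   (chi (padic_dot (rep a - rep b) x) * (ball_ind (p%:R ^+ m) x)%:C%C)).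
  move=> x; rewrite /u normc_sqr step_fourier_inv //.
  set A : R := vol _ * _; set S := \sum_a _.
  have -> : (A%:C%C * S)^*%C = A%:C%C * \sum_(a : I) (h (rep a))%:C%C *
      (chi (padic_dot x (rep a)))^*%C.
    transitivity (conjc A%:C%C * conjc S); first exact: rmorphM.
    rewrite conjc_real; congr (_ * _).
    transitivity (\sum_(a : I) conjc ((h (rep a))%:C%C * chi (padic_dot x (rep a)))).
      exact: rmorph_sum.
    apply: eq_bigr => a _; rewrite -[in RHS](conjc_real (h (rep a))).
    exact: rmorphM.
  rewrite mulrACA big_distrlr /= mulr_sumr; apply: eq_bigr => a _.
  rewrite mulr_sumr; apply: eq_bigr => b _.
  rewrite [padic_dot (_ - _) _]padic_dotC padic_dotDr padic_dotNr padic_charD padic_char_conj.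
  (* The cut-off appears squared on one side and once on the other; splitting on its value 0 or 1
     reconciles the two. *)
  rewrite /k /A /ball_ind; case: ifP => _; rewrite !rmorphM /= ?rmorph0 ?rmorph1; ring.
have ic a b : cintegrable mu
   (fun x => chi (padic_dot (rep a - rep b) x) * (ball_ind (p%:R ^+ m) x)%:C%C).
  have := cintegrable_char mu_haar (rep a - rep b) 0 (lexx _) (pRX_gt0 m).
  by under eq_fun do rewrite subr0.
have ics a := cintegral_sum (fun b => (cintegralZ (k a b)%:C%C (ic a b)).1).
have iu := cintegral_sum (fun a => (ics a).1).
have {}iu : cintegrable mu u /\ cint u = (vol (p%:R ^- m) * \sum_(a : I) h (rep a) ^+ 2)%:C%C.
  rewrite (_ : u = (fun x => \sum_(a : I) \sum_(b : I) (k a b)%:C%C *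
   (chi (padic_dot (rep a - rep b) x) * (ball_ind (p%:R ^+ m) x)%:C%C))); last exact/funext.
  rewrite {}iu.2; split; first exact: iu.1.
  rewrite mulr_sumr rmorph_sum; apply: eq_bigr => a _; rewrite (ics a).2.
  rewrite (eq_bigr (fun b => (vol (p%:R ^- m) * h (rep a) *
     (h (rep b) * ball_ind (p%:R ^- m) (rep a - rep b)))%:C%C)); last first.
    move=> b _; rewrite (cintegralZ _ (ic _ _)).2 large_ball_fourier // -rmorphM.
    congr (_%:C%C); transitivity (vol (p%:R ^- m) * h (rep a) *
     (h (rep b) * ball_ind (p%:R ^- m) (rep a - rep b)) *
       (vol (p%:R ^- m) * vol (p%:R ^+ m))); first by rewrite /k; ring.
    by rewrite haar_volM // mulr1.
  by rewrite -rmorph_sum -mulr_sumr -step_sumE // expr2 mulrA.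
rewrite EFin_int; last exact: iu.1.1.
rewrite EFin_int // (step_integral h2); congr EFin.
by have := iu.2; rewrite /cintegral => -[].
Qed.

End StepInversion.

(** * Lower bounds for quasielliptic polynomials *)

Section QuasiellipticBounds.
Local Open Scope classical_set_scope.
Variables (R : realType) (p : nat) (p_pr : prime p) (n : nat).
Notation Qp := (padic p_pr).
Notation Qpn := 'rV[padic p_pr]_n.
Notation abs := (@padic_abs p p_pr R).
Notation norm := (@padic_norm R p p_pr n).

Let pR_gt0 : 0 < p%:R :> R. Proof. by rewrite ltr0n prime_gt0. Qed.
Let pR_gt1 : 1 < p%:R :> R. Proof. by rewrite ltr1n prime_gt1. Qed.
Let pRX_gt0 k : 0 < p%:R ^+ k :> R. Proof. by rewrite exprn_gt0. Qed.
Let pRN_gt0 k : 0 < p%:R ^- k :> R. Proof. by rewrite invr_gt0. Qed.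

Let pRN_anti j k : (j <= k)%N -> p%:R ^- k <= p%:R ^- j :> R.
Proof. by move=> jk; rewrite lef_pV2 ?posrE // ler_eXn2l. Qed.
Implicit Types x y : Qpn.

Definition padic_continuous_at (h : Qpn -> Qp) (x : Qpn) : Prop :=
  forall e : R, 0 < e -> \forall y \near x, abs (h y - h x) <= e.

Lemma padic_continuous_cst c x : padic_continuous_at (fun=> c) x.
Proof. by move=> e e0; apply: filterS (near_padic_shift x e0) => y _; rewrite subrr padic_abs0 ltW. Qed.

Lemma padic_continuous_coord i x : padic_continuous_at (fun y => y ord0 i) x.
Proof.
move=> e e0; apply: filterS (near_padic_shift x e0) => y; apply: le_trans.
by have := padic_abs_le_norm R (y - x) i; rewrite !mxE.
Qed.

Lemma padic_continuousD g h x : padic_continuous_at g x -> padic_continuous_at h x ->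
  padic_continuous_at (fun y => g y + h y) x.
Proof.
move=> gx hx e e0; apply: filterS2 (gx e e0) (hx e e0) => y gy hy.
by rewrite opprD addrACA; exact: padic_abs_add_le.
Qed.

Lemma padic_continuousM g h x : padic_continuous_at g x -> padic_continuous_at h x ->
  padic_continuous_at (fun y => g y * h y) x.
Proof.
move=> gx hx e e0.
have pos (u : Qp) : 0 < abs u + 1 by rewrite ltr_wpDl ?padic_abs_ge0.
have eg : 0 < e / (abs (h x) + 1) by rewrite divr_gt0.
have eh : 0 < e / (abs (g x) + 1) by rewrite divr_gt0.
apply: filterS3 (gx _ eg) (hx _ eh) (gx _ ltr01) => y gy hy gy1.
have -> : g y * h y - g x * h x = g y * (h y - h x) + (g y - g x) * h x.
  by rewrite mulrBr mulrBl subrKA.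
apply: padic_abs_add_le; rewrite padic_absM.
  apply: le_trans (ler_pM (padic_abs_ge0 _ _) (padic_abs_ge0 _ _) _ hy) _.
    rewrite -(subrK (g x) (g y)); apply: (@padic_abs_add_le _ _ _ _ _ (abs (g x) + 1)).
      by rewrite (le_trans gy1) // lerDr padic_abs_ge0.
    by rewrite lerDl.
  by rewrite mulrC divfK // gt_eqF.
apply: le_trans (ler_wpM2r (padic_abs_ge0 _ _) gy) _.
by rewrite mulrAC ler_pdivrMr // ler_wpM2l ?(ltW e0) // lerDl.
Qed.

Lemma padic_eval_continuous (f : mpoly.mpoly n Qp) x :
  padic_continuous_at (padic_eval f) x.
Proof.
have -> : padic_eval f = fun y => \sum_(m <- mpoly.msupp f)
    mpoly.mcoeff m f * \prod_i y ord0 i ^+ mpoly.fun_of_multinom m i.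
  by apply/funext => y; rewrite /padic_eval mpoly.mevalE.
have prodP (J : Type) (s : seq J) (F : J -> Qpn -> Qp) :
    (forall j, padic_continuous_at (F j) x) ->
    padic_continuous_at (fun y => \prod_(j <- s) F j y) x.
  move=> FP; elim: s => [|j s IH].
    rewrite (_ : (fun _ => _) = (fun=> 1)); first exact: padic_continuous_cst.
    by apply/funext => y; rewrite big_nil.
  rewrite (_ : (fun _ => _) = (fun y => F j y * \prod_(j <- s) F j y)).
    exact: padic_continuousM.
  by apply/funext => y; rewrite big_cons.
elim: (mpoly.msupp f) => [|m s IH].
  rewrite (_ : (fun _ => _) = (fun=> 0)); first exact: padic_continuous_cst.
  by apply/funext => y; rewrite big_nil.
rewrite (_ : (fun _ => _) = (fun y => mpoly.mcoeff m f *
   \prod_i y ord0 i ^+ mpoly.fun_of_multinom m i + \sum_(m <- s)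
    mpoly.mcoeff m f * \prod_i y ord0 i ^+ mpoly.fun_of_multinom m i)); last first.
  by apply/funext => y; rewrite big_cons.
apply: padic_continuousD IH; apply: padic_continuousM; first exact: padic_continuous_cst.
apply: prodP => i; elim: (mpoly.fun_of_multinom m i) => [|k IHk].
  exact: padic_continuous_cst.
rewrite (_ : (fun _ => _) = (fun y : Qpn => y ord0 i * y ord0 i ^+ k)).
  by apply: padic_continuousM IHk; exact: padic_continuous_coord.
by apply/funext => y; rewrite exprS.
Qed.

Variables (f : mpoly.mpoly n Qp) (d : nat) (w : 'I_n -> nat).
Hypothesis fP : quasielliptic f d w.

Lemma quasielliptic_abs_gt0 x : x != 0 -> 0 < abs (padic_eval f x).
Proof.
case: fP => _ _ _ f0 x0; rewrite lt_neqAle padic_abs_ge0 andbT eq_sym.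
by apply: contra_neq x0 => /padic_abs_eq0 /f0.
Qed.

Lemma near_quasielliptic_abs x : x != 0 ->
  \forall y \near x, abs (padic_eval f y) = abs (padic_eval f x).
Proof.
move=> /quasielliptic_abs_gt0 fx.
have e0 : 0 < abs (padic_eval f x) / 2 by rewrite divr_gt0.
apply: filterS (padic_eval_continuous f x e0) => y yx.
rewrite -{1}(subrK (padic_eval f x) (padic_eval f y)) addrC padic_absD_eq //.
by rewrite (le_lt_trans yx) // ltr_pdivrMr // ltr_pMr // ltr1n.
Qed.

(** A polynomial in no variables has a single monomial and would be constant. *)
Lemma quasielliptic_dim : (0 < n)%N.
Proof.
rewrite lt0n; apply/negP => /eqP n0; case: fP => fc _ _ _.
have [] := fc (mpoly.mcoeff (mpoly.mnm0 : mpoly.multinom n) f); apply/mpoly.mpolyP => m.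
have -> : m = mpoly.mnm0.
  by apply/mpoly.mnmP => i; have := ltn_ord i; rewrite {2}n0.
by rewrite mpoly.mcoeffC eqxx mulr1.
Qed.

(** For d = 0, [f] would take the same nonzero value at (1, ..., 1) and at all its rescalings by
    p^k, which tend to 0, against continuity and f(0) = 0. Positivity of [d] is what makes the heat
    symbol decay. *)
Lemma quasielliptic_degree : (0 < d)%N.
Proof.
rewrite lt0n; apply/negP => /eqP d0; case: fP => _ w0 fh f0.
pose x : Qpn := const_mx 1.
have x0 : x != 0.
  apply/eqP => /rowP/(_ (Ordinal quasielliptic_dim)); rewrite !mxE => /eqP.
  by rewrite oner_eq0.
have fx := quasielliptic_abs_gt0 x0.
have e0 : 0 < abs (padic_eval f x) / 2 by rewrite divr_gt0.
have /(nbhs_padic_row R)[k kP] := padic_eval_continuous f 0 e0.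
have pk0 : p%:R ^+ k != 0 :> Qp by rewrite expf_neq0 // (padic_prime_neq0 R).
pose y : Qpn := \row_i ((p%:R ^+ k) ^+ w i * x ord0 i).
have := kP y; rewrite subr0 {2}/y fh // d0 expr0 mul1r.
have -> : padic_eval f 0 = 0 by apply/f0.
rewrite subr0.
have ynorm : norm y <= p%:R ^- k.
  apply/padic_norm_leP => [|i]; first exact: ltW.
  rewrite !mxE mulr1 !padic_absX padic_abs_prime exprVn exprVn.
  rewrite lef_pV2 ?posrE ?exprn_gt0 // -exprM ler_eXn2l //.
  by rewrite leq_pmulr.
by move=> /(_ ynorm); rewrite leNgt ltr_pdivrMr // ltr_pMr // ltr1n.
Qed.

(** Serves only as a common upper bound for all the weights. *)
Definition weight_bound : nat := \sum_i w i.

(** Around each point of the annulus |f| is constant and positive, and compactness extracts one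
    bound. The covering argument runs over the whole unit ball, the claim being vacuous in the
    hole. *)
Lemma quasielliptic_annulus : exists k : nat, forall y : Qpn,
  norm y <= 1 -> p%:R ^- weight_bound <= norm y -> p%:R ^- k <= abs (padic_eval f y).
Proof.
have c1 := @compact_padic_ball R p p_pr n 0; rewrite expr0 in c1.
have := (compact_near_coveringP _).1 c1 nat \oo
  (fun k y => p%:R ^- weight_bound <= norm y -> p%:R ^- k <= abs (padic_eval f y)) _.
case=> [x x1|k _ kP]; last by exists k => y y1; apply: (kP k) => //=.
have [xW|xW] := leP (p%:R ^- weight_bound) (norm x).
  have x0 : x != 0.
    by apply: contraTneq xW => ->; rewrite padic_norm0 -ltNge.
  have [j jx] := natr_expN_lt (prime_gt1 p_pr) (quasielliptic_abs_gt0 x0).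
  near=> y k.
  have yx : abs (padic_eval f y) = abs (padic_eval f x).
    by near: y; exact: near_quasielliptic_abs.
  have jk : (j <= k)%N by near: k; exists j.
  by rewrite yx => _; exact: le_trans (pRN_anti jk) (ltW jx).
(* Points in the hole: neighbours are in the hole too. At the origin the norm is not locally
   constant, hence a separate ball of radius p^-(W + 1), W being [weight_bound]. *)
have yW : \forall y \near x, norm y < p%:R ^- weight_bound.
  have [x0|x0] := eqVneq x 0; last first.
    by apply: filterS (near_padic_norm R x0) => y ->.
  apply: filterS (near_padic_shift x (pRN_gt0 weight_bound.+1)) => y.
  rewrite x0 subr0 => /le_lt_trans; apply.
  by rewrite ltf_pV2 ?posrE // ltr_eXn2l.
near=> y k.
have /lt_geF -> // : norm y < p%:R ^- weight_bound by near: y.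
Unshelve. all: by end_near. Qed.

(** Rescaling by lambda = p^s with minimal s brings [x] into the unit ball. By minimality some |x_i|
    > p^((s - 1) w_i), so the rescaled point has norm at least p^-w_i and lies in the annulus;
    homogeneity then returns the factor p^(s d). *)
Lemma quasielliptic_lower_bound : exists k : nat, forall x : Qpn, exists s : nat,
  (forall i, abs (x ord0 i) <= p%:R ^+ (s * w i)) /\
  ((0 < s)%N -> p%:R ^- k * p%:R ^+ (s * d) <= abs (padic_eval f x)).
Proof.
have [k kP] := quasielliptic_annulus; exists k => x.
case: fP => _ w0 fh f0.
have [s0 s0P] : exists s : nat, [forall i, abs (x ord0 i) <= p%:R ^+ (s * w i)].
  have [s sP] := natr_exp_ge p_pr (norm x); exists s; apply/forallP => i.
  apply: le_trans (padic_abs_le_norm _ _ _) (le_trans sP _).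
  by rewrite ler_eXn2l // leq_pmulr.
have [s /forallP sP smin] := ex_minnP (ex_intro (fun s : nat => is_true [forall i, abs (x ord0 i) <= p%:R ^+ (s * w i)]) s0 s0P).
(* From here on the minimal level is [s.+1], and the condition fails at [s]. *)
exists s; split=> // s_gt0; case: s s_gt0 sP smin => // s _ sP smin.
have [i xi] : exists i, p%:R ^+ (s * w i) < abs (x ord0 i).
  apply: contrapT => H; suff /smin : [forall i, abs (x ord0 i) <= p%:R ^+ (s * w i)].
    by rewrite ltnn.
  by apply/forallP => i; rewrite leNgt; apply/negP => xi; apply: H; exists i.
have ps0 : p%:R ^+ s.+1 != 0 :> Qp by rewrite expf_neq0 // (padic_prime_neq0 R).
have := kP (\row_i ((p%:R ^+ s.+1) ^+ w i * x ord0 i)).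
rewrite fh // padic_absM.
have absw j : abs ((p%:R ^+ s.+1) ^+ j) = p%:R ^- (s.+1 * j).
  by rewrite !padic_absX padic_abs_prime exprVn exprVn -exprM.
rewrite absw => H; rewrite mulrC -ler_pdivlMl // H //.
  apply/padic_norm_leP => // j; rewrite mxE padic_absM absw.
  by rewrite ler_pdivrMl ?mulr1.
apply: le_trans (padic_abs_le_norm _ _ i); rewrite mxE padic_absM absw.
rewrite ler_pdivlMl //; apply: le_trans (ltW xi).
rewrite mulSn exprD mulrAC ger_pMl // ler_pdivrMr // mul1r ler_eXn2l //.
by rewrite /weight_bound (bigD1 i) //= leq_addr.
Qed.

End QuasiellipticBounds.

(** * Decay of the heat symbol and an integrable majorant *)

Section Decay.
Local Open Scope classical_set_scope.
Variables (R : realType) (p : nat) (p_pr : prime p) (n : nat).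
Notation Qp := (padic p_pr).
Notation Qpn := 'rV[padic p_pr]_n.
Notation borel := (g_sigma_algebraType (@open Qpn)).
Notation abs := (@padic_abs p p_pr R).
Notation norm := (@padic_norm R p p_pr n).

Let pR_gt0 : 0 < p%:R :> R. Proof. by rewrite ltr0n prime_gt0. Qed.
Let pR_gt1 : 1 < p%:R :> R. Proof. by rewrite ltr1n prime_gt1. Qed.
Let pRX_gt0 k : 0 < p%:R ^+ k :> R. Proof. by rewrite exprn_gt0. Qed.
Let pRN_gt0 k : 0 < p%:R ^- k :> R. Proof. by rewrite invr_gt0. Qed.

(** Write e^y as the m-th power of e^(y / m) and use e^u >= 1 + u >= u. *)
Lemma expRN_le (y : R) m : 0 < y -> expR (- y) <= (m%:R / y) ^+ m.
Proof.
move=> y0; case: m => [|m].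
  by rewrite expr0 -[leRHS]expR0 ler_expR oppr_le0 ltW.
have m0 : 0 < m.+1%:R :> R by [].
rewrite expRN -[(_ / y)]invrK invf_div exprVn lef_pV2 ?posrE ?expR_gt0 ?exprn_gt0 ?divr_gt0 //.
have -> : expR y = expR (y / m.+1%:R) ^+ m.+1 by rewrite -expRM_natl mulrC divfK ?gt_eqF.
rewrite lerXn2r ?nnegrE ?expR_ge0 ?divr_ge0 ?(ltW y0) //.
by apply: le_trans (expR_ge1Dx _); rewrite lerDr.
Qed.

Lemma powRX (x r : R) k : 0 <= x -> (x ^+ k) `^ r = (x `^ r) ^+ k.
Proof.
by move=> x0; rewrite -(powR_mulrn k x0) -(powR_mulrn k (powR_ge0 _ _)) powRAC.
Qed.

Variables (f : mpoly.mpoly n Qp) (d : nat) (w : 'I_n -> nat).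
Hypothesis fP : quasielliptic f d w.
Variables (alpha t : R).
Hypotheses (alpha_gt0 : 0 < alpha) (t_gt0 : 0 < t).

Let W := weight_bound w.

Lemma Xi_le (x : Qpn) s : (forall i, abs (x ord0 i) <= p%:R ^+ (s * w i)) ->
  Xi R w d x <= n%:R * p%:R ^+ (s * d).
Proof.
move=> xs; case: fP => _ w0 _ _.
rewrite /Xi (@le_trans _ _ (\sum_(i < n) p%:R ^+ (s * d))) //; last first.
  by rewrite sumr_const card_ord mulr_natl.
apply: ler_sum => i _.
have -> : p%:R ^+ (s * d) = (p%:R ^+ (s * w i)) `^ (d%:R / (w i)%:R) :> R.
  rewrite -!powR_mulrn ?(ltW pR_gt0) // -powRrM !natrM -mulrA [(w i)%:R * _]mulrC.
  by rewrite divfK // pnatr_eq0 -lt0n.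
by apply: ge0_ler_powR; rewrite ?nnegrE ?padic_abs_ge0 ?divr_ge0 ?(ltW (pRX_gt0 _)).
Qed.

Lemma Xi_ge0 (x : Qpn) : 0 <= Xi R w d x.
Proof. by apply: sumr_ge0 => i _; exact: powR_ge0. Qed.

Lemma heat_symbol_le1 (x : Qpn) : heat_symbol f alpha t x <= 1.
Proof.
by rewrite /heat_symbol -[leRHS]expR0 ler_expR mulNr oppr_le0 mulr_ge0 ?powR_ge0 ?ltW.
Qed.

(** Exponential decay in Q^s beats any prescribed power p^(-s M): take m with p^M <= Q^m in
    [expRN_le]. The summand 1 of the constant covers s = 0. *)
Lemma heat_symbol_decay M : exists2 c : R, 0 <= c & forall x : Qpn, exists s : nat,
  (forall i, abs (x ord0 i) <= p%:R ^+ (s * w i)) /\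
  heat_symbol f alpha t x <= c * p%:R ^- (s * M).
Proof.
have [k kP] := quasielliptic_lower_bound R fP.
(* With these, a Q^s is t times the alpha-th power of the lower bound p^-k p^(s d) for |f|. *)
pose Q : R := (p%:R ^+ d) `^ alpha; pose a := t * (p%:R ^- k) `^ alpha.
have a0 : 0 < a by rewrite mulr_gt0 // powR_gt0.
have Q0 : 0 < Q by rewrite powR_gt0.
(* Since d >= 1 gives Q >= p^alpha, it is enough that alpha m >= M. *)
have [m mQ] : exists m, p%:R ^+ M <= Q ^+ m.
  exists (Num.bound (M%:R / alpha)).
  set m := Num.bound _.
  have Mm : M%:R <= alpha * m%:R.
    rewrite mulrC -ler_pdivrMr // ltW // archi_boundP //.
    by rewrite divr_ge0 // ltW.
  rewrite /Q -(powR_mulrn m (powR_ge0 _ _)) -powRrM.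
  rewrite -(powR_mulrn M (ltW pR_gt0)).
  apply: (@le_trans _ _ (p%:R `^ (alpha * m%:R))).
    by apply: ler_powR => //; exact: ltW.
  apply: ge0_ler_powR; rewrite ?nnegrE ?mulr_ge0 ?(ltW pR_gt0) ?(ltW (pRX_gt0 _)) ?(ltW alpha_gt0) //.
  rewrite -[leLHS]expr1 ler_eXn2l //; exact: quasielliptic_degree fP.
exists (1 + (m%:R / a) ^+ m).
  by rewrite addr_ge0 // exprn_ge0 // divr_ge0 // ltW.
move=> x; have [s [xs fs]] := kP x; exists s; split=> //.
have [s0|s0] := posnP s.
  rewrite s0 mul0n expr0 invr1 mulr1 (le_trans (heat_symbol_le1 x)) // lerDl.
  by rewrite exprn_ge0 // divr_ge0 // ltW.
have {}fs : a * Q ^+ s <= t * abs (padic_eval f x) `^ alpha.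
  rewrite /a -mulrA ler_pM2l //.
  rewrite /Q -powRX ?(ltW (pRX_gt0 _)) // -exprM -powRM ?(ltW (pRX_gt0 _)) ?(ltW (pRN_gt0 _)) //.
  apply: ge0_ler_powR; rewrite ?nnegrE ?padic_abs_ge0 ?mulr_ge0 ?(ltW alpha_gt0) ?(ltW (pRX_gt0 _)) ?(ltW (pRN_gt0 _)) //.
  by rewrite mulnC; exact: fs.
apply: (@le_trans _ _ (expR (- (a * Q ^+ s)))).
  by rewrite /heat_symbol ler_expR mulNr lerN2.
have aQ0 : 0 < a * Q ^+ s by rewrite mulr_gt0 ?exprn_gt0.
apply: (le_trans (expRN_le m aQ0)).
rewrite invfM mulrA exprMn ler_pM ?exprn_ge0 ?divr_ge0 ?(ltW a0) //.
- by rewrite invr_ge0 exprn_ge0 // ltW.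
- by rewrite lerDr.
rewrite exprVn lef_pV2 ?posrE ?exprn_gt0 // mulnC exprM [leRHS]exprAC.
by rewrite lerXn2r ?nnegrE ?exprn_ge0 ?(ltW pR_gt0) ?(ltW Q0).
Qed.

(** The weight costs at most n^b p^(s d b), which is paid by asking for the decay exponent d b +
    N. *)
Lemma weighted_heat_decay b N : exists2 c : R, 0 <= c & forall x : Qpn, exists s : nat,
  norm x <= p%:R ^+ (s * W) /\
  Xi R w d x ^+ b * heat_symbol f alpha t x <= c * p%:R ^- (s * N).
Proof.
have [c c0 cP] := heat_symbol_decay (d * b + N).
exists (n%:R ^+ b * c); first by rewrite mulr_ge0 // exprn_ge0.
move=> x; have [s [xs hs]] := cP x; exists s; split.
  apply/padic_norm_leP => [|i]; first exact: ltW.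
  rewrite (le_trans (xs i)) // ler_eXn2l // leq_mul2l /W /weight_bound (bigD1 i) //=.
  by rewrite leq_addr orbT.
have Xb : Xi R w d x ^+ b <= (n%:R * p%:R ^+ (s * d)) ^+ b.
  by rewrite lerXn2r ?nnegrE ?Xi_ge0 ?mulr_ge0 ?(ltW (pRX_gt0 _)) // Xi_le.
apply: le_trans (ler_pM _ _ Xb hs) _; rewrite ?exprn_ge0 ?Xi_ge0 ?expR_ge0 //.
rewrite exprMn -exprM mulnDr exprD invfM mulnA.
rewrite [leLHS](_ : _ = n%:R ^+ b * c * p%:R ^- (s * N) * (p%:R ^+ (s * d * b) / p%:R ^+ (s * d * b))).
  by rewrite mulfV ?mulr1 // gt_eqF.
ring.
Qed.

Variable mu : {measure set borel -> \bar R}.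
Hypothesis mu_haar : normalized_haar mu.

(** The exponent W n cancels the volume of the ball of radius p^(s W); the extra 1 makes the series
    converge. *)
Let N := (W * n + 1)%N.

(** The level s of a point is only known to exist; summing over all levels avoids selecting it
    measurably. *)
Definition majorant (x : Qpn) : \bar R :=
  (\sum_(0 <= s <oo) (p%:R ^- (s * N) * ball_ind (p%:R ^+ (s * W)) x : R)%:E)%E.

Let term_ge0 s (x : Qpn) :
  (0 <= (p%:R ^- (s * N) * ball_ind (p%:R ^+ (s * W)) x : R)%:E)%E.
Proof. by rewrite lee_fin mulr_ge0 ?ball_ind_ge0 ?(ltW (pRN_gt0 _)). Qed.

Let measurable_term s : measurable_fun [set: borel]
  (fun x : borel => (p%:R ^- (s * N) * ball_ind (p%:R ^+ (s * W)) (x : Qpn) : R)%:E).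
Proof.
apply/measurable_EFinP; apply: measurable_funM => //.
have := measurable_ball_ind (R := R) (0 : Qpn) (pRX_gt0 (s * W)).
by under eq_fun do rewrite subr0.
Qed.

Lemma majorant_ge0 x : (0 <= majorant x)%E.
Proof. by apply: nneseries_ge0 => s _ _. Qed.

Lemma majorant_ge s (x : Qpn) : norm x <= p%:R ^+ (s * W) ->
  ((p%:R ^- (s * N) : R)%:E <= majorant x)%E.
Proof.
move=> xs; rewrite /majorant; apply: le_trans (nneseries_lim_ge s.+1 _); last first.
  by move=> k _ _; exact: term_ge0.
rewrite big_nat_recr //= -[leLHS]add0e; apply: leeD; first exact: sume_ge0.
by rewrite /ball_ind xs mulr1.
Qed.

Lemma measurable_majorant : measurable_fun [set: borel] (majorant : borel -> \bar R).
Proof.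
by apply: ge0_emeasurable_sum => // s x _ _; exact: term_ge0.
Qed.

(** The bound is shaped for induction: as p >= 2, the new term p^-k is at most 2 p^-k - 2
    p^-(k+1). *)
Lemma geometric_partial_le k : \sum_(0 <= s < k) p%:R ^- s <= 2 - 2 * p%:R ^- k :> R.
Proof.
elim: k => [|k IH]; first by rewrite big_nil expr0 invr1 mulr1 subrr.
rewrite big_nat_recr //=; apply: le_trans (lerD IH (lexx _)) _.
have : p%:R ^- k.+1 <= p%:R ^- k / 2 :> R.
  rewrite exprS invfM mulrC ler_pM2l // lef_pV2 ?posrE //.
  by rewrite ler_nat prime_gt1.
by move=> h; lra.
Qed.

(** The term of level s integrates to p^-(s N) p^(s W n) = p^-s. *)
Lemma integrable_majorant : mu.-integrable [set: borel] (majorant : borel -> \bar R).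
Proof.
apply/integrableP; split; first exact: measurable_majorant.
under eq_integral do rewrite gee0_abs ?majorant_ge0 //.
rewrite /majorant integral_nneseries //.
suff h : (\sum_(0 <= s <oo) \int[mu]_x (p%:R ^- (s * N) * ball_ind (p%:R ^+ (s * W)) x)%:E
    <= (2 : R)%:E)%E by exact: le_lt_trans h (ltry _).
apply: lime_le.
  by apply: is_cvg_nneseries => s _ _; apply: integral_ge0 => x _; exact: term_ge0.
apply: nearW => k.
rewrite (eq_bigr (fun s => (p%:R ^- s : R)%:E)).
  rewrite sumEFin lee_fin (le_trans (geometric_partial_le k)) // gerBl.
  by rewrite mulr_ge0 // ltW.
move=> s _; under eq_integral do rewrite EFinM.
rewrite ge0_integralZl_EFin //; last 2 first.
- by move=> x _; rewrite lee_fin ball_ind_ge0.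
- apply/measurable_EFinP.
  have := measurable_ball_ind (R := R) (0 : Qpn) (pRX_gt0 (s * W)).
  by under eq_fun do rewrite subr0.
have -> : (\int[mu]_x (ball_ind (p%:R ^+ (s * W)) x : R)%:E =
    mu (padic_ball (p%:R ^+ (s * W) : R)))%E.
  rewrite -(integral_ball_ind mu_haar 0 (pRX_gt0 (s * W))).
  by apply: eq_integral => x _; rewrite subr0.
rewrite (haar_ballE mu_haar (lexx _)) // haar_vol_large // -EFinM; congr EFin.
rewrite /N mulnDr muln1 exprD invfM mulnA mulrAC mulVf ?mul1r //.
by rewrite gt_eqF.
Qed.

Lemma weighted_heat_majorant b : exists2 c : R, 0 <= c & forall x : Qpn,
  ((Xi R w d x ^+ b * heat_symbol f alpha t x)%:E <= c%:E * majorant x)%E.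
Proof.
have [c c0 cP] := weighted_heat_decay b N; exists c => // x.
have [s [xs hs]] := cP x.
apply: (@le_trans _ _ (c%:E * (p%:R ^- (s * N))%:E)%E); first by rewrite -EFinM lee_fin.
by apply: lee_wpmul2l; rewrite ?lee_fin // majorant_ge.
Qed.

End Decay.

Lemma limn_einf_le_cst (R : realType) (u : nat -> \bar R) (l : \bar R) :
  (forall k, (u k <= l)%E) -> (limn_einf u <= l)%E.
Proof.
move=> ul; rewrite limn_einf_lim; apply: lime_le; first exact: is_cvg_einfs.
apply: nearW => k; apply: le_trans (ul k); apply: ereal_inf_lbound.
by exists k => //=.
Qed.

(** * Truncation of the symbol and passage to the limit *)

Section SymbolInversion.
Local Open Scope classical_set_scope.
Variables (R : realType) (p : nat) (p_pr : prime p) (n : nat).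
Notation Qp := (padic p_pr).
Notation Qpn := 'rV[padic p_pr]_n.
Notation borel := (g_sigma_algebraType (@open Qpn)).
Notation abs := (@padic_abs p p_pr R).
Notation norm := (@padic_norm R p p_pr n).
Notation chi := (@padic_char R p p_pr).
Variable mu : {measure set borel -> \bar R}.
Hypothesis mu_haar : normalized_haar mu.
Variables (f : mpoly.mpoly n Qp) (d : nat) (w : 'I_n -> nat).
Hypothesis fP : quasielliptic f d w.
Variables (alpha t : R).
Hypotheses (alpha_gt0 : 0 < alpha) (t_gt0 : 0 < t).
Variable g : Qpn -> R.
Hypothesis g_ge0 : forall x, 0 <= g x.
Hypothesis g_le : forall x, g x <= heat_symbol f alpha t x.
Hypothesis g_near : forall x : Qpn, x != 0 -> \forall y \near x, g y = g x.

Let pR_gt0 : 0 < p%:R :> R. Proof. by rewrite ltr0n prime_gt0. Qed.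
Let pR_gt1 : 1 < p%:R :> R. Proof. by rewrite ltr1n prime_gt1. Qed.
Let pRX_gt0 k : 0 < p%:R ^+ k :> R. Proof. by rewrite exprn_gt0. Qed.
Let pRN_gt0 k : 0 < p%:R ^- k :> R. Proof. by rewrite invr_gt0. Qed.
Let pRN_anti j k : (j <= k)%N -> p%:R ^- k <= p%:R ^- j :> R.
Proof. by move=> jk; rewrite lef_pV2 ?posrE // ler_eXn2l. Qed.

Implicit Types x y : Qpn.
Notation major := (majorant R (p_pr := p_pr) w).

(** Balls around 0 have volume p^-(k n), which tends to 0 because n > 0. *)
Lemma haar_point_negligible : mu.-negligible [set (0 : borel)].
Proof.
have m0 : measurable [set (0 : borel)].
  exact: closed_measurable_borel (@closed_padic0 R p p_pr n).
exists [set (0 : borel)]; split=> //.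
apply/eqP; rewrite eq_le measure_ge0 andbT; apply/lee_addgt0Pr => e e0.
rewrite add0e; have [k ke] := natr_expN_lt (prime_gt1 p_pr) e0.
apply: (@le_trans _ _ (mu (padic_ball (p%:R ^- k : R)))).
  apply: le_measure; rewrite ?inE //; first exact: measurable_padic_ball.
  by move=> x ->; rewrite /padic_ball /= padic_norm0 ltW.
rewrite haar_small_ball // lee_fin (le_trans _ (ltW ke)) // lef_pV2 ?posrE //; last first.
  by rewrite ltr0n !expn_gt0 prime_gt0.
have n_gt0 := quasielliptic_dim fP.
by rewrite -natrX ler_nat -[leqLHS]expn1 leq_pexp2l // expn_gt0 prime_gt0.
Qed.

Lemma ae_padic_neq0 (P : borel -> Prop) :
  (forall x : Qpn, x != 0 -> P x) -> \forall x \ae mu, P x.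
Proof.
move=> PP; apply: negligibleS haar_point_negligible => x /= nP.
by apply: contrapT => /eqP /PP.
Qed.

Lemma measurable_off0 (h : Qpn -> R) :
  (forall x, x != 0 -> \forall y \near x, h y = h x) ->
  measurable_fun [set: borel] (h : borel -> R).
Proof.
move=> hP; apply: (measurable_locally_constant_off (c := h 0) (@closed_padic0 R p p_pr n)).
  by move=> x ->.
by move=> x /eqP; exact: hP.
Qed.

(** Each |x_i| is locally constant off the closed hyperplane x_i = 0. *)
Lemma measurable_Xi : measurable_fun [set: borel] (Xi R w d : borel -> R).
Proof.
apply: measurable_sum => i.
have cD : closed [set x : Qpn | x ord0 i = 0].
  apply: closed_near => x /eqP xi0; apply: filterS (near_padic_coord R xi0) => y yx /= yi0.
  by move: yx; rewrite yi0 padic_abs0 => /esym /padic_abs_eq0/eqP; rewrite (negPf xi0).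
apply: (measurable_locally_constant_off (c := 0 `^ (d%:R / (w i)%:R)) cD).
  by move=> x /= ->; rewrite padic_abs0.
by move=> x /eqP xi0; apply: filterS (near_padic_coord R xi0) => y ->.
Qed.

Lemma dominated_off0 (F : nat -> Qpn -> R) (L : Qpn -> R) c :
  (forall k, measurable_fun [set: borel] (F k : borel -> R)) ->
  measurable_fun [set: borel] (L : borel -> R) ->
  (forall x, x != 0 -> \forall k \near \oo, F k x = L x) ->
  (forall k x, (`|F k x|%:E <= c%:E * major x)%E) ->
  mu.-integrable [set: borel] (EFin \o (L : borel -> R)) /\
  (\int[mu]_x (F k x)%:E)%E @[k --> \oo] --> (\int[mu]_x (L x)%:E)%E.
Proof.
move=> mF mL FL Fc.
have ig := integrableZl measurableT c (integrable_majorant w mu_haar).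
have mF' k : measurable_fun [set: borel] (EFin \o (F k : borel -> R)).
  exact/measurable_EFinP.
have mL' : measurable_fun [set: borel] (EFin \o (L : borel -> R)).
  exact/measurable_EFinP.
have FL' : \forall x \ae mu, [set: borel] x ->
    (EFin \o (F k : borel -> R)) x @[k --> \oo] --> (EFin \o (L : borel -> R)) x.
  apply: ae_padic_neq0 => x x0 _; apply: cvg_near_cst.
  by apply: filterS (FL x x0) => k /= ->.
have Fc' : \forall x \ae mu, forall k, [set: borel] x ->
    (`|(EFin \o (F k : borel -> R)) x| <= c%:E * major x)%E.
  by apply: aeW => x k _; exact: Fc.
by have [iL _ cL] := dominated_convergence measurableT mF' mL' FL' ig Fc'.
Qed.

Lemma g_le1 x : g x <= 1.
Proof. exact: le_trans (g_le x) (heat_symbol_le1 _ _ t_gt0 _). Qed.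

Definition trunc (k : nat) (x : Qpn) : R :=
  if p%:R ^- k < norm x <= p%:R ^+ k then g x else 0.

Lemma trunc_step k : exists m, step m (trunc k).
Proof.
apply: (@locally_constant_step R p p_pr n k) => x.
  have [->|x0] := eqVneq x 0.
    apply: filterS (near_padic_shift 0 (pRN_gt0 k)) => y; rewrite subr0 => yk.
    by rewrite /trunc padic_norm0 [_ < norm y]ltNge yk [_ < 0]ltNge (ltW (pRN_gt0 k)).
  apply: filterS2 (near_padic_norm R x0) (g_near x0) => y ny gy.
  by rewrite /trunc ny gy.
by move=> xk; rewrite /trunc [_ <= p%:R ^+ k]leNgt xk andbF.
Qed.

Lemma trunc0 k : trunc k 0 = 0.
Proof. by rewrite /trunc padic_norm0 ltNge (ltW (pRN_gt0 k)). Qed.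

Lemma near_truncE x : x != 0 -> \forall k \near \oo, trunc k x = g x.
Proof.
move=> x0; have nx := padic_norm_gt0 R x0.
have [j1 j1x] := natr_expN_lt (prime_gt1 p_pr) nx.
have [j2 j2x] := natr_exp_ge p_pr (norm x).
exists (maxn j1 j2) => // k /=; rewrite geq_max => /andP[k1 k2].
rewrite /trunc (le_lt_trans (pRN_anti k1)) //= (le_trans j2x) //.
by rewrite ler_eXn2l.
Qed.

Lemma trunc_bound k x : 0 <= trunc k x <= g x.
Proof. by rewrite /trunc; case: ifP; rewrite lexx ?g_ge0. Qed.

(** Both values lie in [0, g] and g <= 1, so the square is at most g. The bound does not depend on
    [k], as dominated convergence requires. *)
Lemma trunc_dist k x : (trunc k x - g x) ^+ 2 <= heat_symbol f alpha t x.
Proof.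
apply: le_trans (g_le x); have := g_le1 x; have := g_ge0 x.
have /andP[] := trunc_bound k x => T0 Tg g0 g1.
by rewrite -sqrrN opprB expr2 -[leRHS]mul1r ler_pM //; lra.
Qed.

(** On the smaller annulus both truncations equal g; off it the first vanishes and the second is at
    most g. *)
Lemma trunc_dist_mono j k x : (k <= j)%N ->
  (trunc k x - trunc j x) ^+ 2 <= (trunc k x - g x) ^+ 2.
Proof.
move=> kj; rewrite {1 3}/trunc; case: ifPn => [/andP[kx xk]|_].
  have xj : norm x <= p%:R ^+ j by apply: le_trans xk _; rewrite ler_eXn2l.
  by rewrite /trunc (le_lt_trans (pRN_anti kj) kx) xj.
rewrite !sub0r !sqrrN; have /andP[T0 Tg] := trunc_bound j x.
by rewrite lerXn2r ?nnegrE ?g_ge0.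
Qed.

Notation finv h := (fourier_inv mu (fun xi => (h xi)%:C%C)).

Lemma trunc_fourierK k : fourier mu (finv (trunc k)) = fun xi => (trunc k xi)%:C%C.
Proof.
by have [m hm] := trunc_step k; apply/funext => xi; rewrite (step_fourierK mu_haar xi hm).
Qed.

Lemma trunc_schwartz k : schwartz_bruhat (finv (trunc k)).
Proof. by have [m hm] := trunc_step k; exact: (step_schwartz mu_haar hm). Qed.

Lemma measurable_trunc k : measurable_fun [set: borel] (trunc k : borel -> R).
Proof.
have [m hm] := trunc_step k.
by apply: measurable_locally_constant; exact: step_locally_constant hm.
Qed.

Lemma measurable_g : measurable_fun [set: borel] (g : borel -> R).
Proof. exact: measurable_off0. Qed.

Lemma L2sqdist_real (W : Qpn -> R) (u v : Qpn -> R) :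
  L2sqdist mu W (fun x => (u x)%:C%C) (fun x => (v x)%:C%C) =
  (\int[mu]_x (W x * (u x - v x) ^+ 2)%:E)%E.
Proof.
apply: eq_integral => x _; rewrite -rmorphB normc_real.
by rewrite real_normK // num_real.
Qed.

(** Dominated convergence with the majorant for the exponent 2 beta; by inversion the transforms are
    the truncations themselves. *)
Lemma trunc_weighted_cvg (beta : nat) :
  L2sqdist mu (fun xi => Xi R w d xi `^ (2 * beta%:R))
    (fourier mu (finv (trunc k))) (fun xi => (g xi)%:C%C) @[k --> \oo] --> 0%E.
Proof.
have XiE x : Xi R w d x `^ (2 * beta%:R) = Xi R w d x ^+ (2 * beta).
  by rewrite -natrM powR_mulrn // Xi_ge0.
have [c c0 cP] := weighted_heat_majorant fP alpha_gt0 t_gt0 (2 * beta).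
pose F k x := Xi R w d x ^+ (2 * beta) * (trunc k x - g x) ^+ 2.
have mF k : measurable_fun [set: borel] (F k : borel -> R).
  apply: measurable_funM; first by apply: measurable_funX; exact: measurable_Xi.
  by apply: measurable_funX; apply: measurable_funB; [exact: measurable_trunc|exact: measurable_g].
have F0 x : x != 0 -> \forall k \near \oo, F k x = cst 0 x.
  by move=> x0; apply: filterS (near_truncE x0) => k; rewrite /F => ->; rewrite subrr expr0n mulr0.
have Fc k x : (`|F k x|%:E <= c%:E * major x)%E.
  apply: le_trans (cP x); rewrite lee_fin ger0_norm.
    by rewrite ler_wpM2l ?exprn_ge0 ?Xi_ge0 // trunc_dist.
  by rewrite mulr_ge0 ?sqr_ge0 // exprn_ge0 // Xi_ge0.
have m0 : measurable_fun [set: borel] (cst 0 : borel -> R) by exact: measurable_cst.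
have [_] := dominated_off0 mF m0 F0 Fc.
rewrite integral0; apply: cvg_trans.
rewrite (_ : (fun k => L2sqdist _ _ _ _) = (fun k => \int[mu]_x (F k x)%:E)%E) //.
apply/funext => k; rewrite trunc_fourierK L2sqdist_real; apply: eq_integral => x _.
by rewrite /F XiE.
Qed.

(** The majorant with b = 0 bounds the symbol itself. The factor [h] will be the real or imaginary
    part of a character. *)
Lemma cvg_Rintegral_trunc (h : Qpn -> R) :
  (forall x, \forall y \near x, h y = h x) -> (forall x, `|h x| <= 1) ->
  \int[mu]_x (h x * trunc k x) @[k --> \oo] --> \int[mu]_x (h x * g x).
Proof.
move=> hl h1.
have [c c0 cP] := weighted_heat_majorant fP alpha_gt0 t_gt0 0.
have mh : measurable_fun [set: borel] (h : borel -> R).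
  exact: measurable_locally_constant.
have mF k : measurable_fun [set: borel] (fun x : borel => h x * trunc k x).
  by apply: measurable_funM; [exact: mh|exact: measurable_trunc].
have mL : measurable_fun [set: borel] (fun x : borel => h x * g x).
  by apply: measurable_funM; [exact: mh|exact: measurable_g].
have FL x : x != 0 -> \forall k \near \oo, h x * trunc k x = h x * g x.
  by move=> x0; apply: filterS (near_truncE x0) => k ->.
have Fc k x : (`|h x * trunc k x|%:E <= c%:E * major x)%E.
  apply: le_trans (cP x); rewrite lee_fin expr0 mul1r normrM.
  have /andP[T0 Tg] := trunc_bound k x.
  rewrite [X in _ * X]ger0_norm // -[leRHS]mul1r ler_pM //.
  exact: le_trans Tg (g_le x).
have [iL cL] := dominated_off0 mF mL FL Fc.
apply: (@fine_cvg _ _ _ _ (fun k => \int[mu]_x (h x * trunc k x)%:E)%E).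
by rewrite fineK //; exact: integrable_fin_num.
Qed.

Lemma finv_trunc_cvg_Re x :
  complex.Re (finv (trunc k) x) @[k --> \oo] --> complex.Re (finv g x).
Proof.
have e (h : Qpn -> R) : complex.Re (finv h x) =
    \int[mu]_xi (complex.Re (chi (padic_dot x xi)) * h xi).
  rewrite /fourier_inv /cintegral /=; apply: eq_Rintegral => xi _.
  by case: (chi (padic_dot x xi)) => a b /=; rewrite mulr0 subr0.
rewrite e (_ : (fun k => _) = (fun k =>
   \int[mu]_xi (complex.Re (chi (padic_dot x xi)) * trunc k xi))); last exact/funext.
apply: cvg_Rintegral_trunc => xi.
  apply: filterS (near_padic_char R xi x) => y.
  by rewrite !(padic_dotC x) => ->.
by rewrite /padic_char /= ler_norml cos_geN1 cos_le1.
Qed.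

Lemma finv_trunc_cvg_Im x :
  complex.Im (finv (trunc k) x) @[k --> \oo] --> complex.Im (finv g x).
Proof.
have e (h : Qpn -> R) : complex.Im (finv h x) =
    \int[mu]_xi (complex.Im (chi (padic_dot x xi)) * h xi).
  rewrite /fourier_inv /cintegral /=; apply: eq_Rintegral => xi _.
  by case: (chi (padic_dot x xi)) => a b /=; rewrite mulr0 add0r.
rewrite e (_ : (fun k => _) = (fun k =>
   \int[mu]_xi (complex.Im (chi (padic_dot x xi)) * trunc k xi))); last exact/funext.
apply: cvg_Rintegral_trunc => xi.
  apply: filterS (near_padic_char R xi x) => y.
  by rewrite !(padic_dotC x) => ->.
by rewrite /padic_char /= ler_norml sin_geN1 sin_le1.
Qed.

Lemma cmeasurable_finv_trunc k : cmeasurable (finv (trunc k)).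
Proof.
have [fl _] := trunc_schwartz k.
by split; apply: measurable_locally_constant => x; apply: filterS (fl x) => y ->.
Qed.

Lemma cmeasurable_finv : cmeasurable (finv g).
Proof.
split.
  apply: (@measurable_fun_cvg _ _ _ _ (fun k (x : borel) => complex.Re (finv (trunc k) x))).
    by move=> k; exact: (cmeasurable_finv_trunc k).1.
  by move=> x _; exact: finv_trunc_cvg_Re.
apply: (@measurable_fun_cvg _ _ _ _ (fun k (x : borel) => complex.Im (finv (trunc k) x))).
  by move=> k; exact: (cmeasurable_finv_trunc k).2.
by move=> x _; exact: finv_trunc_cvg_Im.
Qed.

(** At a common level [m] the explicit formula for the inverse transform is linear in the step
    function, so Plancherel applies to the difference. *)
Lemma trunc_plancherel j k :
  L2sqdist mu (cst 1) (finv (trunc k)) (finv (trunc j)) =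
  (\int[mu]_x ((trunc k x - trunc j x) ^+ 2)%:E)%E.
Proof.
have [m1 h1] := trunc_step k; have [m2 h2] := trunc_step j.
have {}h1 := step_mono (leq_maxl m1 m2) h1.
have {}h2 := step_mono (leq_maxr m1 m2) h2.
move: (maxn m1 m2) h1 h2 => m h1 h2 {m1 m2}.
have h12 : step m (fun x => trunc k x - trunc j x).
  split=> [x y ym|x xm]; first by rewrite h1.1 // h2.1.
  by rewrite h1.2 // h2.2 // subrr.
rewrite -(step_plancherel mu_haar h12); apply: eq_integral => x _.
rewrite mul1r (step_fourier_inv mu_haar x h12) (step_fourier_inv mu_haar x h1).
rewrite (step_fourier_inv mu_haar x h2) -mulrBr -sumrB; congr (Normc.normc (_ * _) ^+ 2)%:E.
by apply: eq_bigr => a _; rewrite rmorphB /= mulrBl.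
Qed.

(** Fatou in [j] with [k] fixed: the integrand is the pointwise limit of squared distances to later
    truncations, whose integrals are bounded through Plancherel and [trunc_dist_mono]. *)
Lemma finv_trunc_dist k :
  (L2sqdist mu (cst 1%R) (finv (trunc k)) (finv g) <=
   \int[mu]_x ((trunc k x - g x) ^+ 2)%:E)%E.
Proof.
(* The shift j + k puts every compared truncation after [k], so the bound holds for all [j] and not
   just eventually. *)
pose D j (x : borel) : \bar R :=
  (cst 1 x * Normc.normc (finv (trunc k) x - finv (trunc (j + k)) x) ^+ 2)%:E.
have normE (z : R[i]) : Normc.normc z ^+ 2 = complex.Re z ^+ 2 + complex.Im z ^+ 2.
  by case: z => a b; rewrite /Normc.normc sqr_sqrtr // addr_ge0 ?sqr_ge0.
have DE j x : D j x = (
   (complex.Re (finv (trunc k) x) - complex.Re (finv (trunc (j + k)) x)) ^+ 2 +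
   (complex.Im (finv (trunc k) x) - complex.Im (finv (trunc (j + k)) x)) ^+ 2)%:E.
  by rewrite /D mul1r normE; case: (finv _ x) (finv _ x) => [a b] [a' b'].
have mD j : measurable_fun [set: borel] (D j).
  rewrite (_ : D j = EFin \o (fun x : borel =>
   (complex.Re (finv (trunc k) x) - complex.Re (finv (trunc (j + k)) x)) ^+ 2 +
   (complex.Im (finv (trunc k) x) - complex.Im (finv (trunc (j + k)) x)) ^+ 2)).
    have [mr mi] := cmeasurable_finv_trunc k.
    have [mr' mi'] := cmeasurable_finv_trunc (j + k).
    by apply/measurable_EFinP; apply: measurable_funD; apply: measurable_funX;
       apply: measurable_funB.
  by apply/funext => x; rewrite DE.
have D0 j x : [set: borel] x -> (0 <= D j x)%E.
  by move=> _; rewrite lee_fin mul1r sqr_ge0.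
have := fatou mu measurableT mD D0.
have -> : (fun x => limn_einf (D^~ x)) = (fun x : borel =>
   (cst 1 x * Normc.normc (finv (trunc k) x - finv g x) ^+ 2)%:E).
  apply/funext => x; apply: (cvg_limn_einf_sup _).1.
  rewrite [X in _ --> X](_ : _ = ((complex.Re (finv (trunc k) x) - complex.Re (finv g x)) ^+ 2 +
    (complex.Im (finv (trunc k) x) - complex.Im (finv g x)) ^+ 2)%:E); last first.
    by rewrite mul1r normE; case: (finv _ x) (finv _ x) => [a b] [a' b'].
  rewrite (_ : D^~ x = EFin \o (fun j =>
   (complex.Re (finv (trunc k) x) - complex.Re (finv (trunc (j + k)) x)) ^+ 2 +
   (complex.Im (finv (trunc k) x) - complex.Im (finv (trunc (j + k)) x)) ^+ 2)); last first.
    by apply/funext => j; rewrite /= DE.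
  apply: cvg_EFin; first exact: nearW.
  have cr : complex.Re (finv (trunc (j + k)) x) @[j --> \oo] --> complex.Re (finv g x).
    rewrite (cvg_shiftn k (fun j => complex.Re (finv (trunc j) x))).
    exact: finv_trunc_cvg_Re.
  have ci : complex.Im (finv (trunc (j + k)) x) @[j --> \oo] --> complex.Im (finv g x).
    rewrite (cvg_shiftn k (fun j => complex.Im (finv (trunc j) x))).
    exact: finv_trunc_cvg_Im.
  have cB (a : R) (v : nat -> R) l : v j @[j --> \oo] --> l ->
      (a - v j) ^+ 2 @[j --> \oo] --> (a - l) ^+ 2.
    by move=> vl; rewrite expr2; under eq_fun do rewrite expr2;
       apply: cvgM; apply: cvgB => //; exact: cvg_cst.
  by apply: cvgD; apply: cB.
move=> /le_trans; apply; apply: limn_einf_le_cst => j.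
rewrite [leLHS](trunc_plancherel (j + k) k); apply: ge0_le_integral => //.
- by move=> x _; rewrite lee_fin sqr_ge0.
- apply/measurable_EFinP; apply: measurable_funX; apply: measurable_funB; exact: measurable_trunc.
- apply/measurable_EFinP; apply: measurable_funX; apply: measurable_funB.
    exact: measurable_trunc.
  exact: measurable_g.
by move=> x _; rewrite lee_fin trunc_dist_mono // leq_addl.
Qed.

Theorem symbol_Htilde_infty : Htilde_infty mu w d (finv g).
Proof.
have cg : cmeasurable (fun xi => (g xi)%:C%C).
  by split; [exact: measurable_g|exact: measurable_cst].
(* At beta = 0 the weight is 1 everywhere, the origin included, since a zeroth real power is 1. *)
have w0 v : L2sqdist mu (fun xi => Xi R w d xi `^ (2 * 0%:R)) v (fun xi => (g xi)%:C%C) =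
    L2sqdist mu (cst 1) v (fun xi => (g xi)%:C%C) :> \bar R.
  by apply: eq_integral => x _; rewrite mulr0 powRr0.
have c0 := trunc_weighted_cvg 0.
rewrite (_ : (fun k => L2sqdist _ _ _ _) = (fun k => L2sqdist mu (cst 1)
   (fourier mu (finv (trunc k))) (fun xi => (g xi)%:C%C))) in c0; last first.
  by apply/funext => k; rewrite w0.
exists (fun xi => (g xi)%:C%C); split.
  split=> //; first exact: cmeasurable_finv.
  exists (fun k => finv (trunc k)); split=> // [k|]; first exact: trunc_schwartz.
  (* The distances between inverse transforms are squeezed below those between the symbols, already
     known to tend to 0. *)
  apply: (squeeze_cvge _ (cvg_cst 0%E) c0); apply: nearW => k; apply/andP; split.
    by apply: integral_ge0 => x _; rewrite lee_fin mul1r sqr_ge0.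
  apply: le_trans (finv_trunc_dist k) _; rewrite trunc_fourierK L2sqdist_real.
  by under [leRHS]eq_integral do rewrite mul1r.
move=> beta; split=> //; exists (fun k => finv (trunc k)); split; last exact: trunc_weighted_cvg.
move=> k; split; first exact: trunc_schwartz.
by rewrite trunc_fourierK trunc0.
Qed.

End SymbolInversion.

Theorem theorem6p4 (R : realType) (p : nat) (p_pr : prime p) (n : nat)
    (mu : {measure set (g_sigma_algebraType (@open 'rV[padic p_pr]_n)) -> \bar R})
    (mu_haar : normalized_haar mu)
    (f : mpoly.mpoly n (padic p_pr)) (d : nat) (w : 'I_n -> nat)
    (f_quasielliptic : quasielliptic f d w)
    (f_integral : padic_integer_coeffs f)
    (alpha : R) (alpha_gt0 : 0 < alpha) :
  (forall (r : nat) (t : R), (0 < r)%N -> 0 < t ->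
     Htilde_infty mu w d (varphi mu f alpha r t)) /\
  (forall t : R, 0 < t -> Htilde_infty mu w d (heat_kernel mu f alpha t)).
Proof.
have heat_near (t : R) (x : 'rV[padic p_pr]_n) : x != 0 ->
    \forall y \near x, heat_symbol f alpha t y = heat_symbol f alpha t x.
  move=> x0; apply: filterS (near_quasielliptic_abs R f_quasielliptic x0) => y yx.
  by rewrite /heat_symbol yx.
split=> [r t _ t_gt0|t t_gt0]; last first.
  (* [heat_kernel] unfolds to the inverse transform of the full heat symbol, which is its own upper
     bound. *)
  apply: (symbol_Htilde_infty mu_haar f_quasielliptic alpha_gt0 t_gt0) => //.
    by move=> x; exact: expR_ge0.
  exact: heat_near.
have Omega01 (x : 'rV[padic p_pr]_n) : 0 <= 1 - Omega R (- r%:Z) x <= 1.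
  by rewrite /Omega; case: ifP => _; rewrite ?subrr ?subr0 ?lexx ?ler01.
apply: (symbol_Htilde_infty mu_haar f_quasielliptic alpha_gt0 t_gt0) => x.
- by rewrite mulr_ge0 ?expR_ge0 //; have /andP[] := Omega01 x.
- by rewrite ler_piMl ?expR_ge0 //; have /andP[] := Omega01 x.
(* The cut-off [Omega] is locally constant even at its boundary, since its radius p^-r is
   positive. *)
move=> x0; have c0 : 0 < p%:R ^ (- r%:Z) :> R by rewrite exprz_gt0 // ltr0n prime_gt0.
apply: filterS2 (near_padic_norm_le x c0) (heat_near t x x0) => y yx ->.
by rewrite /Omega yx.
Qed.
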